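(* Let $E_{/\mathbb{Q}}$ be an elliptic curve of Mordell–Weil rank $r_E\geq 1$ with $\mathrm{Sha}(E/\mathbb{Q})$ finite, and let $\ddag\in\{+,-\}$. Let $S^{\mathrm{bad}}$ be the set of primes of bad reduction and $S^{\mathrm{ss}}$ the set of primes of good supersingular reduction of $E$. Assume the following conjecture ($p$-adic Birch and Swinnerton-Dyer): for every odd $p\in S^{\mathrm{ss}}$ with $a_p(E)=0$, one has $f_E^{(p),\ddag}(T)=T^{r_E}g_E^{(p),\ddag}(T)$ with $g_E^{(p),\ddag}(T)\in\Lambda$ and $$g_E^{(p),\ddag}(0)\sim\left(\frac{R_p^{\ddag}(E/\mathbb{Q})}{p^{r_E}}\right)\times\#\mathrm{Sha}(E/\mathbb{Q})[p^\infty]\times\Big(\prod_{l\in S^{\mathrm{bad}}}c_l(E)\Big).$$ Let $\Sigma$ be the set of primes $p$ of good ordinary reduction with $p\mid\#\widetilde E(\mathbb{F}_p)$; let $\Sigma'$ be the finite set of primes $p$ such that $p=2$, or $p\mid\#\mathrm{Sha}(E/\mathbb{Q})$, or $p\mid\prod_{l\in S^{\mathrm{bad}}}c_l(E)$; and let $\Pi^{\ddag}\subset S^{\mathrm{ss}}$ be the set of primes $p$ for which $p$ divides $R_p^{\ddag}(E/\mathbb{Q})/p^{r_E}$, i.e. $v_p\big(R_p^{\ddag}(E/\mathbb{Q})/p^{r_E}\big)\ge1$ (including the case $R_p^{\ddag}(E/\mathbb{Q})=0$). Then for all primes $p\in S^{\mathrm{ss}}\setminus(\Sigma\cup\Sigma'\cup\Pi^{\ddag})$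 with $a_p(E)=0$ we have $f_E^{(p),\ddag}(T)=T^{r_E}$. In particular, $\mu_p^{\ddag}(E)=0$ and $\lambda_p^{\ddag}(E)=r_E$.
   Context: $\mathrm{Sha}(E/\mathbb{Q})$ is the Tate–Shafarevich group, $c_l(E)=[E(\mathbb{Q}_l):E_0(\mathbb{Q}_l)]$, $\widetilde E$ the reduction of $E$ at $p$, $a_p(E)=p+1-\#\widetilde E(\mathbb{F}_p)$ (for supersingular $p\ge5$ automatically $a_p=0$), $v_p$ the valuation with $v_p(p)=1$; for $a,b\in\mathbb{Q}_p$, $a\sim b$ means $a=bu$ with $u\in\mathbb{Z}_p^\times$. Signed Selmer groups. Let $p$ be odd, supersingular. $\mathbb{Q}^{\mathrm{cyc}}$ is the cyclotomic $\mathbb{Z}_p$-extension, $\mathbb{Q}_n^{\mathrm{cyc}}$ its $n$-th layer, $\mathfrak p$ the unique prime above $p$; $\Gamma=\mathrm{Gal}(\mathbb{Q}^{\mathrm{cyc}}/\mathbb{Q})$, $\Lambda=\mathbb{Z}_p[[\Gamma]]\cong\mathbb{Z}_p[[T]]$ via $\gamma-1\mapsto T$, $\gamma$ a fixed topological generator. $S$ is the set of primes dividing $Np$ ($N$ the conductor), $\mathbb{Q}_S$ the maximal algebraic extension unramified at the primes outside $S$. $\widehat E$ is the formal group over $\mathbb{Z}_p$, $\widehat E(L)=\widehat E(\mathfrak m_L)$. $\widehat E^{+}(\mathbb{Q}^{\mathrm{cyc}}_{n,\mathfrak p})$ (resp. $\widehat E^{-}$) is the set of $P\in\widehat E(\mathbb{Q}^{\mathrm{cyc}}_{n,\mathfrak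 p})$ with $\mathrm{tr}_{n/m+1}(P)\in\widehat E(\mathbb{Q}^{\mathrm{cyc}}_{m,\mathfrak p})$ for all even (resp. odd) $0\le m<n$, with $\mathrm{tr}_{n/m+1}:\widehat E(\mathbb{Q}^{\mathrm{cyc}}_{n,\mathfrak p})\to\widehat E(\mathbb{Q}^{\mathrm{cyc}}_{m+1,\mathfrak p})$ the trace; $\mathbb{Q}^{\mathrm{cyc}}_{\mathfrak p}=\bigcup_n\mathbb{Q}^{\mathrm{cyc}}_{n,\mathfrak p}$, $\widehat E^{\pm}(\mathbb{Q}^{\mathrm{cyc}}_{\mathfrak p})=\bigcup_n\widehat E^{\pm}(\mathbb{Q}^{\mathrm{cyc}}_{n,\mathfrak p})$. Put $J_p^{\pm}=H^1(\mathbb{Q}^{\mathrm{cyc}}_{\mathfrak p},E[p^\infty])/(\widehat E^{\pm}(\mathbb{Q}^{\mathrm{cyc}}_{\mathfrak p})\otimes\mathbb{Q}_p/\mathbb{Z}_p)$ and, for $v\in S\setminus\{p\}$, $J_v^{\pm}=\varinjlim_L\bigoplus_{w|v}H^1(L_w,E)[p^\infty]$ ($L$ over number fields in $\mathbb{Q}^{\mathrm{cyc}}$). Then $\mathrm{Sel}^{\pm}_{p^\infty}(E/\mathbb{Q}^{\mathrm{cyc}})=\ker\{H^1(\mathbb{Q}_S/\mathbb{Q}^{\mathrm{cyc}},E[p^\infty])\to\bigoplus_{v\in S}J_v^{\pm}\}$, a cofinitely generated cotorsion $\Lambda$-module (Kobayashi). Characteristic element. For a cofinitely generated cotorsion $\Lambda$-module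 $M$, $M^\vee$ is pseudo-isomorphic to $\bigoplus_i\Lambda/(p^{m_i})\oplus\bigoplus_j\Lambda/(h_j(T))$ with $m_i>0$, $h_j$ distinguished polynomials (monic, non-leading coefficients divisible by $p$); its characteristic element is $p^{\sum m_i}\prod_jh_j(T)$, $\mu=\sum m_i$, $\lambda=\sum\deg h_j$. For $M=\mathrm{Sel}^{\ddag}_{p^\infty}(E/\mathbb{Q}^{\mathrm{cyc}})$ these are $f_E^{(p),\ddag}(T)$, $\mu_p^{\ddag}(E)$, $\lambda_p^{\ddag}(E)$. Signed $p$-adic regulators $R_p^{\pm}(E/\mathbb{Q})\in\mathbb{Q}_p$ (Bernardi–Perrin-Riou, Sprung), defined up to $\mathbb{Z}_p^\times$. Take a minimal Weierstrass equation with invariant differential $\omega$, $\eta=x\omega$, $t=-x/y$; $D=H^1_{dR}(E/\mathbb{Q}_p)=\mathbb{Q}_p\omega\oplus\mathbb{Q}_p\eta$, with $\varphi$ equal to $p^{-1}$ times crystalline Frobenius, so $\varphi^2=-p^{-1}$ when $a_p=0$, and alternating form with $[\omega,\eta]=1$. Let $\sigma(t)=t+\cdots\in\mathbb{Q}_p[[t]]$ be the odd solution of $\frac{d}{\omega}\big(\frac1\sigma\frac{d\sigma}{\omega}\big)=-x(t)$. For nontorsion $P\in E(\mathbb{Q})$ sufficiently close to the identity $p$-adically and with nonsingular reduction at every prime, put $h_\omega(P)=-\log_{E,\omega}(P)^2$ ($\log_{E,\omega}$ the formal logarithm) and $h_\eta(P)=2\log_p(\sigma(t(P))/e(P))$,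 $e(P)>0$ the square root of the denominator of $x(P)$; extend quadratically to $E(\mathbb{Q})$, let $h_{a\omega+b\eta}=ah_\omega+bh_\eta$ with pairing $\langle P,Q\rangle_\nu=\frac12(h_\nu(P+Q)-h_\nu(P)-h_\nu(Q))$, and let $\mathrm{Reg}_\nu$ be its determinant on a $\mathbb{Z}$-basis of $E(\mathbb{Q})$ modulo torsion. There is a unique $\mathrm{Reg}_p\in D$ with $[\mathrm{Reg}_p,\nu]=\mathrm{Reg}_\nu/[\omega,\nu]^{r_E-1}$ for all $\nu\notin\mathbb{Q}_p\omega$. Then $R_p^{\pm}(E/\mathbb{Q})$ are given, up to units, by $(1-\varphi)^2\mathrm{Reg}_p=p^{-1}R_p^{+}(E/\mathbb{Q})\,\omega-R_p^{-}(E/\mathbb{Q})\,\varphi(\omega)$. *)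

(* Defs.v *)
From HB Require Import structures.
From mathcomp Require Import all_boot all_order all_algebra all_field.
From mathcomp Require Import all_classical all_reals.
From mathcomp Require Import finmap complex.

Set Implicit Arguments.
Unset Strict Implicit.
Unset Printing Implicit Defensive.

Import Order.TTheory GRing.Theory Num.Theory.

Local Open Scope classical_set_scope.
Local Open Scope ring_scope.

(* Cardinal of a finite set; 0 for an infinite one. *)
Definition card {T : choiceType} (A : set T) : nat := #|` fset_set A|%fset.

Record prime_number := PrimeNumber {
  prime_val :> nat;
  prime_valP : prime prime_val }.

HB.instance Definition _ := [isSub for prime_val].
HB.instance Definition _ := [Choice of prime_number by <:].

(* val_ge v x n means v(x) >= n, with the convention v(0) = +oo; the value of
   v at 0 is never used. *)
Definition val_ge (K : fieldType) (v : K -> rat) (x : K) (n : rat) : Prop :=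
  x = 0 \/ n <= v x.

(* Topological closure of a subset of K for the v-adic topology. *)
Definition val_closure (K : fieldType) (v : K -> rat) (A : set K) : set K :=
  [set x | forall N : nat, exists2 a, A a & val_ge v (x - a) N%:R].

(* An algebraic closure of Q_p, with its valuation normalised by v(p) = 1.
   Q_p is realised inside it as the closure of Q; the last two fields say that
   this closure is complete and that the big field is algebraic over it, so
   that the pair (field, valuation) is determined up to isomorphism. *)
Record padic_closure (p : nat) := PadicClosure {
  pc_field :> closedFieldType;
  pc_val : pc_field -> rat;
  pc_char0 : [pchar pc_field] =i pred0;
  pc_valM : forall x y, x != 0 -> y != 0 -> pc_val (x * y) = pc_val x + pc_val y;
  pc_valD : forall x y, x != 0 -> y != 0 -> x + y != 0 ->
    Num.min (pc_val x) (pc_val y) <= pc_val (x + y);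
  pc_valp : pc_val p%:R = 1;
  pc_complete : forall u : nat -> rat,
    (forall N : nat, exists n0 : nat, forall m n : nat, (n0 <= m)%N -> (n0 <= n)%N ->
       val_ge pc_val (ratr (u m) - ratr (u n)) N%:R) ->
    exists x, forall N : nat, exists n0 : nat, forall n : nat, (n0 <= n)%N ->
       val_ge pc_val (ratr (u n) - x) N%:R;
  pc_algebraic : forall x, exists q : {poly pc_field},
    [/\ q != 0, forall i, val_closure pc_val (range ratr) q`_i & root q x] }.

Section Padic.
Variables (p : nat) (K : padic_closure p).

Definition vge (x : K) (n : rat) : Prop := val_ge (@pc_val p K) x n.
Definition Qp : set K := val_closure (@pc_val p K) (range ratr).
Definition Zp : set K := [set x | Qp x /\ vge x 0].
Definition Zp_unit : set K := [set x | [/\ Qp x, x != 0 & pc_val x = 0]].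
Definition up_to_unit (a b : K) : Prop := exists2 u, Zp_unit u & a = b * u.

End Padic.

Arguments Qp {p} K.
Arguments Zp {p} K.

Section PowerSeries.
Variable K : fieldType.
Implicit Types a b : nat -> K.

Definition psC (c : K) : nat -> K := fun n => c *+ (n == 0%N).
Definition psX (k : nat) : nat -> K := fun n => (n == k)%:R.
Definition ps_add a b : nat -> K := fun n => a n + b n.
Definition ps_opp a : nat -> K := fun n => - a n.
Definition ps_sub a b : nat -> K := fun n => a n - b n.
Definition ps_scale (c : K) a : nat -> K := fun n => c * a n.
Definition ps_mul a b : nat -> K := fun n => \sum_(i < n.+1) a i * b (n - i)%N.
Definition ps_exp a k : nat -> K := iter k (ps_mul a) (psC 1).
Definition ps_deriv a : nat -> K := fun n => a n.+1 *+ n.+1.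
(* 1/a for a(0) = 1: the geometric series in 1 - a *)
Definition ps_inv a : nat -> K :=
  fun n => \sum_(k < n.+1) ps_exp (ps_sub (psC 1) a) k n.
(* a(b(T)) for b(0) = 0 *)
Definition ps_comp a b : nat -> K := fun n => \sum_(k < n.+1) a k * ps_exp b k n.

End PowerSeries.

(* s is the sum of the v-adically convergent series sum_n a_n z^n *)
Definition ps_eval p (K : padic_closure p) (a : nat -> K) (z s : K) : Prop :=
  forall N : nat, exists n0 : nat, forall n : nat, (n0 <= n)%N ->
    vge (\sum_(k < n) a k * z ^+ k - s) N%:R.

Record weierstrass := Weierstrass { wa1 : int; wa2 : int; wa3 : int; wa4 : int; wa6 : int }.

Definition disc (W : weierstrass) : int :=
  let: Weierstrass a1 a2 a3 a4 a6 := W in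
  let b2 := a1 ^+ 2 + 4 * a2 in
  let b4 := 2 * a4 + a1 * a3 in
  let b6 := a3 ^+ 2 + 4 * a6 in
  let b8 := a1 ^+ 2 * a6 + 4 * a2 * a6 - a1 * a3 * a4 + a2 * a3 ^+ 2 - a4 ^+ 2 in
  - (b2 ^+ 2 * b8) - 8 * b4 ^+ 3 - 27 * b6 ^+ 2 + 9 * b2 * b4 * b6.

(* W' is obtained from W by x = u^2 x' + r, y = u^3 y' + s u^2 x' + t *)
Definition wiso (W W' : weierstrass) : Prop :=
  let: Weierstrass a1 a2 a3 a4 a6 := W in
  let: Weierstrass c1 c2 c3 c4 c6 := W' in
  exists u r s t : rat,
    [/\ u != 0,
        u * c1%:~R = a1%:~R + 2 * s,
        u ^+ 2 * c2%:~R = a2%:~R - s * a1%:~R + 3 * r - s ^+ 2,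
        u ^+ 3 * c3%:~R = a3%:~R + r * a1%:~R + 2 * t &
        u ^+ 4 * c4%:~R = a4%:~R - s * a3%:~R + 2 * r * a2%:~R
                          - (t + r * s) * a1%:~R + 3 * r ^+ 2 - 2 * s * t /\
        u ^+ 6 * c6%:~R = a6%:~R + r * a4%:~R + r ^+ 2 * a2%:~R + r ^+ 3
                          - t * a3%:~R - t ^+ 2 - r * t * a1%:~R].

Definition minimal (W : weierstrass) : Prop := forall W', wiso W W' -> (disc W %| disc W')%Z.

(* An elliptic curve over Q, given by a global minimal Weierstrass equation
   (one exists for every elliptic curve over Q). *)
Record elliptic_curve := EllipticCurve {
  ec_eqn :> weierstrass;
  ec_disc : disc ec_eqn != 0;
  ec_minimal : minimal ec_eqn }.

Notation point F := (option (F * F)%type).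

Section Points.
Variables (W : weierstrass) (F : fieldType).

Local Notation a1 := ((wa1 W)%:~R : F).
Local Notation a2 := ((wa2 W)%:~R : F).
Local Notation a3 := ((wa3 W)%:~R : F).
Local Notation a4 := ((wa4 W)%:~R : F).
Local Notation a6 := ((wa6 W)%:~R : F).

Definition on_curve (P : point F) : bool :=
  if P is Some (x, y)
  then y ^+ 2 + a1 * x * y + a3 * y == x ^+ 3 + a2 * x ^+ 2 + a4 * x + a6
  else true.

Definition pt_neg (P : point F) : point F :=
  if P is Some (x, y) then Some (x, - y - a1 * x - a3) else None.

Definition pt_add (P Q : point F) : point F :=
  match P, Q with
  | None, _ => Q
  | _, None => P
  | Some (x1, y1), Some (x2, y2) =>
    if (x1 == x2) && (y1 + y2 + a1 * x2 + a3 == 0) then None else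
    let l := if x1 == x2
             then (3 * x1 ^+ 2 + 2 * a2 * x1 + a4 - a1 * y1) / (2 * y1 + a1 * x1 + a3)
             else (y2 - y1) / (x2 - x1) in
    let x3 := l ^+ 2 + a1 * l - a2 - x1 - x2 in
    Some (x3, - (l + a1) * x3 - (y1 - l * x1) - a3)
  end.

Definition pt_sub (P Q : point F) : point F := pt_add P (pt_neg Q).
Definition pt_muln (n : nat) (P : point F) : point F := iter n (pt_add P) None.
Definition pt_mulz (n : int) (P : point F) : point F :=
  match n with Posz k => pt_muln k P | Negz k => pt_neg (pt_muln k.+1 P) end.

Definition E_ : set (point F) := [set P | on_curve P].
Definition torsion : set (point F) :=
  [set P | E_ P /\ exists2 n, (0 < n)%N & pt_muln n P = None].
Definition tors_p (p : nat) : set (point F) :=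
  [set P | E_ P /\ exists k, pt_muln (p ^ k) P = None].

Definition coords_in (L : set F) : set (point F) :=
  [set P | if P is Some (x, y) then L x /\ L y else True].

End Points.

Arguments E_ W {F}.
Arguments torsion W {F}.
Arguments tors_p W {F} p.

Definition map_pt (F F' : Type) (f : F -> F') (P : point F) : point F' :=
  if P is Some (x, y) then Some (f x, f y) else None.

Definition mw_basis (W : weierstrass) (r : nat) (B : 'I_r -> point rat) : Prop :=
  (forall i, E_ W (B i)) /\
  forall P, E_ W P -> exists! n : {ffun 'I_r -> int},
    torsion W (pt_sub W P (\big[pt_add W (F:=rat)/None]_(i < r) pt_mulz W (n i) (B i))).

Definition mw_rank (W : weierstrass) (r : nat) : Prop :=
  exists B : 'I_r -> point rat, mw_basis W B.

Section Reduction.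
Variable E : elliptic_curve.

Definition Sbad : set prime_number := [set p : prime_number | (p %| disc E)%Z].

Definition num_points (p : prime_number) : nat := #|[pred P : point 'F_p | on_curve E P]|.

Definition a_ (p : prime_number) : int := p%:Z + 1 - (num_points p)%:Z.

(* Good reduction, and the reduced curve has no nontrivial geometric p-torsion *)
Definition Sss : set prime_number :=
  [set p : prime_number | ~ Sbad p /\
     forall k : fieldType, (p : nat) \in [pchar k] ->
     forall P : point k, E_ E P -> pt_muln E p P = None -> P = None].

Definition Sord : set prime_number := [set p : prime_number | ~ Sbad p /\ ~ Sss p].

Variables (p : nat) (K : padic_closure p).

(* E_0(Q_p): points of E(Q_p) with nonsingular reduction *)
Definition E0 : set (point K) :=
  [set P | [/\ E_ E P, coords_in (Qp K) P &
    (* reduction to infinity, or a partial derivative that is nonzero mod p *)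
    if P is Some (x, y) then
      [\/ ~ vge x 0, ~ vge (2 * y + (wa1 E)%:~R * x + (wa3 E)%:~R) 1 |
          ~ vge (3 * x ^+ 2 + 2 * (wa2 E)%:~R * x + (wa4 E)%:~R - (wa1 E)%:~R * y) 1]
    else True] ].

(* c_p(E) = [E(Q_p) : E_0(Q_p)], counting the cosets P + E_0(Q_p) *)
Definition tamagawa : nat :=
  card [set [set pt_add E P Q | Q in E0] | P in E_ E `&` coords_in (Qp K)].

End Reduction.

Definition Gal (F : fieldType) (L : set F) : set (F -> F) :=
  [set s | [/\ zmod_morphism s, monoid_morphism s, bijective s &
              forall x, L x -> s x = x]].

(* inverse of an injective map on its image, 0 elsewhere *)
Definition inv_map (F F' : fieldType) (f : F -> F') : F' -> F :=
  fun y => xget 0 [set x | f x = y].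

(* restriction to the algebraic numbers of an automorphism t of K, along the
   embedding j *)
Definition res_gal (K : fieldType) (j : algC -> K) (t : K -> K) : algC -> algC :=
  inv_map j \o t \o j.

(* Cochains with values in E(Qbar). Only their values on the Galois group under
   consideration are meaningful. *)
Notation cochain := ((algC -> algC) -> point algC).

Section Cohomology.
Variables (W : weierstrass) (G : set (algC -> algC)) (M : set (point algC)).

(* continuous 1-cocycles of the profinite group G in the discrete module M *)
Definition cocycle (c : cochain) : Prop :=
  [/\ forall s, G s -> M (c s),
      forall s t, G s -> G t -> c (s \o t) = pt_add W (c s) (map_pt s (c t)) &
      forall s, G s -> exists xs : seq algC,
        forall t, G t -> {in xs, s =1 t} -> c t = c s].

Definition cohomologous (c d : cochain) : Prop :=
  exists2 P, M P & forall s, G s -> c s = pt_add W (d s) (pt_sub W (map_pt s P) P).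

Definition coh_class (c : cochain) : set cochain :=
  [set d | cocycle d /\ cohomologous c d].

End Cohomology.

(* The restriction of the class of c to Gal(K/L_j) dies in H^1(Gal(K/L_j), E(K)),
   for every embedding j of Qbar in K; letting j vary amounts to letting the
   place vary among those above a given place of Q. *)
Definition locally_trivial (W : weierstrass) (K : fieldType)
    (L : {rmorphism algC -> K} -> set K) (c : cochain) : Prop :=
  forall j : {rmorphism algC -> K},
    exists2 P : point K, E_ W P &
      forall t, Gal (L j) t -> map_pt j (c (res_gal j t)) = pt_sub W (map_pt t P) P.

Definition GQ : set (algC -> algC) := Gal (range (ratr : rat -> algC)).

Section Sha.
Variables (R : realType) (Qbar : forall l : prime_number, padic_closure l).
Variable (W : weierstrass).

Definition sha_cocycle (c : cochain) : Prop :=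
  [/\ cocycle W GQ (E_ W) c,
      forall l : prime_number, locally_trivial W (fun _ => Qp (Qbar l)) c &
      locally_trivial W (fun _ => [set z : R[i] | complex.Im z = 0]) c].

Definition Sha : set (set cochain) :=
  [set coh_class W GQ (E_ W) c | c in sha_cocycle].

Definition Sha_p (p : nat) : set (set cochain) :=
  [set coh_class W GQ (E_ W) c | c in
    [set c | sha_cocycle c /\
       exists k, cohomologous W GQ (E_ W) (fun s => pt_muln W (p ^ k) (c s)) (fun=> None)]].

End Sha.

Section Cyclotomic.
Variable p : nat.

(* Q_n^cyc for odd p: the subfield of Q(mu_{p^(n+1)}) fixed by the elements of
   order dividing p-1 of Gal(Q(mu_{p^(n+1)})/Q) = (Z/p^(n+1))^* *)
Definition Qcyc_layer (n : nat) : set algC :=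
  [set x | exists z : algC,
    [/\ (p ^ n.+1).-primitive_root z,
        exists q : {poly rat}, x = (map_poly ratr q).[z] &
        forall s, GQ s -> iter p.-1 s z = z -> s x = x]].

Definition Qcyc : set algC := \bigcup_n Qcyc_layer n.

(* g is an automorphism of Qbar with inverse gi, and g restricts to a
   topological generator of Gal(Q^cyc/Q) *)
Definition cyc_generator (g gi : algC -> algC) : Prop :=
  [/\ GQ g, cancel g gi, cancel gi g &
    forall s, GQ s -> forall n, exists k,
      forall x, Qcyc_layer n x -> s x = iter k g x].

End Cyclotomic.

Section LocalFields.
Variables (l : nat) (K : padic_closure l) (j : {rmorphism algC -> K}).

Definition inertia : set (algC -> algC) :=
  [set s | GQ s /\ forall x, vge (j x) 0 ->
    j (s x - x) = 0 \/ 0 < pc_val (j (s x - x))].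

Definition completion (L : set algC) : set K :=
  val_closure (@pc_val l K) (j @` L).

End LocalFields.

(* Q_S: a field is unramified at l if and only if all the inertia groups above
   l act trivially on it *)
Definition QS (Qbar : forall l : prime_number, padic_closure l)
    (S : set prime_number) : set algC :=
  [set x | forall l : prime_number, ~ S l -> forall (j : {rmorphism algC -> Qbar l}) s,
     inertia j s -> s x = x].

Section FormalGroup.
Variables (W : weierstrass) (K : fieldType).

Local Notation a1 := ((wa1 W)%:~R : K).
Local Notation a2 := ((wa2 W)%:~R : K).
Local Notation a3 := ((wa3 W)%:~R : K).
Local Notation a4 := ((wa4 W)%:~R : K).
Local Notation a6 := ((wa6 W)%:~R : K).

Local Notation "a *' b" := (ps_mul a b) (at level 40, left associativity).
Local Notation "a +' b" := (ps_add a b) (at level 50, left associativity).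
Local Notation t := (psX K 1).

(* w = -1/y as a power series in t = -x/y: the unique w in t K[[t]] with
   w = t^3 + a1 t w + a2 t^2 w + a3 w^2 + a4 t w^2 + a6 w^3.
   Each iteration from 0 determines at least one more coefficient. *)
Definition w_step (w : nat -> K) : nat -> K :=
  psX K 3 +' ps_scale a1 (t *' w) +' ps_scale a2 (t *' t *' w)
  +' ps_scale a3 (w *' w) +' ps_scale a4 (t *' w *' w) +' ps_scale a6 (w *' w *' w).
Definition w_ser : nat -> K := fun n => iter n.+1 w_step (psC 0) n.

(* t^2 x(t) = t^3 / w(t) *)
Definition t2x_ser : nat -> K := ps_inv (fun n => w_ser (n + 3)%N).

(* omega / dt = x'(t) / (2y + a1 x + a3), both sides of the fraction being
   multiplied by - t^3 / 2 *)
Definition omega_ser : nat -> K :=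
  ps_sub t2x_ser (ps_scale 2^-1 (t *' ps_deriv t2x_ser))
  *' ps_inv (ps_sub t2x_ser
       (ps_scale 2^-1 (ps_scale a1 (t *' t2x_ser) +' ps_scale a3 (psX K 3)))).

(* integral of omega, i.e. the formal logarithm *)
Definition log_ser : nat -> K := fun n => if n is m.+1 then omega_ser m / n%:R else 0.

(* Coefficients of t^n, n >= 1, in the integral of eta = x omega; the polar part
   -1/t is left out. *)
Definition eta_int_ser : nat -> K :=
  fun n => if n is _.+1 then (t2x_ser *' omega_ser) n.+1 / n%:R else 0.

(* [-1](t) = t / (-1 + a1 t + a3 w(t)) *)
Definition inv_ser : nat -> K :=
  ps_opp (t *' ps_inv (ps_sub (psC 1) (ps_scale a1 t +' ps_scale a3 w_ser))).

Definition d_omega (a : nat -> K) : nat -> K := ps_deriv a *' ps_inv omega_ser.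

(* sigma = t + O(t^2) is odd and d/omega (1/sigma dsigma/omega) = -x(t); the
   equation is multiplied by t^2 sigma^2 *)
Definition is_sigma (s : nat -> K) : Prop :=
  [/\ s 0 = 0, s 1 = 1, ps_comp s inv_ser = ps_opp s &
      psX K 2 *' (ps_sub (s *' d_omega (d_omega s)) (d_omega s *' d_omega s))
      = ps_opp (t2x_ser *' (s *' s))].

End FormalGroup.

Section FormalPoints.
Variables (W : weierstrass) (p : nat) (K : padic_closure p).

(* The point (t/w(t), -1/w(t)) of E with parameter t in the maximal ideal; this
   identifies the formal group on the maximal ideal with a subgroup of E. *)
Definition formal_point (t : K) (P : point K) : Prop :=
  if t == 0 then P = None
  else exists2 w, ps_eval (@w_ser W K) t w & P = Some (t / w, - w^-1).

Definition Ehat (L : set K) : set (point K) :=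
  [set P | exists t, [/\ L t, t = 0 \/ 0 < pc_val t & formal_point t P]].

(* Q is the trace of P from L' to L: the sum of its conjugates over a set of
   representatives of Gal(K/L) modulo Gal(K/L') *)
Definition is_trace (L' L : set K) (P Q : point K) : Prop :=
  exists (d : nat) (s : 'I_d -> K -> K),
    [/\ forall i, Gal L (s i),
        forall t, Gal L t -> exists! i, forall x, L' x -> t x = s i x &
        Q = \big[pt_add W (F:=K)/None]_(i < d) map_pt (s i) P].

End FormalPoints.

Variant sign := Plus | Minus.

Definition has_parity (e : sign) (m : nat) : bool :=
  match e with Plus => ~~ odd m | Minus => odd m end.

Section Selmer.
Variables (Qbar : forall l : prime_number, padic_closure l).
Variables (E : elliptic_curve) (p : prime_number) (e : sign).

Section AtP.
Variable j : {rmorphism algC -> Qbar p}.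

Definition Lp (n : nat) : set (Qbar p) := completion j (Qcyc_layer p n).
Definition Lp_infty : set (Qbar p) := \bigcup_n Lp n.

Definition Ehat_signed_layer (n : nat) : set (point (Qbar p)) :=
  [set P | Ehat E (Lp n) P /\
    forall m, (m < n)%N -> has_parity e m ->
      exists2 Q, is_trace E (Lp n) (Lp m.+1) P Q & Ehat E (Lp m) Q].

Definition Ehat_signed : set (point (Qbar p)) := \bigcup_n Ehat_signed_layer n.

(* The class of c in H^1(Q^cyc_p, E[p^oo]) is the Kummer image of an element
   of E^{+-}(Q^cyc_p) (x) Q_p/Z_p; such an element can be written P (x) p^-k, and
   its Kummer class is that of t |-> tR - R where p^k R = P. *)
Definition in_signed_Kummer (c : cochain) : Prop :=
  exists (P : point (Qbar p)) (k : nat) (R T : point (Qbar p)),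
    [/\ Ehat_signed P, E_ E R, pt_muln E (p ^ k) R = P, tors_p E p T &
      forall t, Gal Lp_infty t ->
        map_pt j (c (res_gal j t)) =
          pt_add E (pt_sub E (map_pt t R) R) (pt_sub E (map_pt t T) T)].

End AtP.

Definition S_ : set prime_number := [set l : prime_number | Sbad E l \/ l = p].

(* Continuous cocycles of Gal(Q_S/L) in E[p^oo], inflated to Gal(Qbar/L) *)
Definition S_cocycle (L : set algC) (c : cochain) : Prop :=
  cocycle E (Gal L) (tors_p E p) c /\
  forall s t, Gal L s -> Gal L t -> (forall x, QS Qbar S_ x -> s x = t x) -> c s = c t.

Definition coh (c d : cochain) : Prop :=
  cohomologous E (Gal (Qcyc p)) (tors_p E p) c d.

(* Cocycles representing the elements of Sel. At l <> p, J_l is a direct limit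
   over the layers: the image of c in J_l is zero if and only if c comes from
   a class over some layer Q_n that is trivial at all the places above l. *)
Definition Sel (c : cochain) : Prop :=
  [/\ S_cocycle (Qcyc p) c,
      forall j, in_signed_Kummer j c &
      forall l, S_ l -> l <> p -> exists n d,
        [/\ S_cocycle (Qcyc_layer p n) d, coh c d &
            locally_trivial E
              (fun j : {rmorphism algC -> Qbar l} => completion j (Qcyc_layer p n)) d]].

Variables (g gi : algC -> algC).

Let K := Qbar p.
Let ZP : set K := Zp K.

(* Elements of the Pontryagin dual Hom(Sel, Q_p/Z_p) are represented by Q_p-valued
   functions on cocycles, read modulo Z_p. *)
Definition dual_Sel (f : cochain -> K) : Prop :=
  [/\ forall c, Sel c -> Qp K (f c),
      forall c d, Sel c -> Sel d -> ZP (f (fun s => pt_add E (c s) (d s)) - f c - f d) &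
      forall c d, Sel c -> Sel d -> coh c d -> ZP (f c - f d)].

Definition dual_eq (f f' : cochain -> K) : Prop := forall c, Sel c -> ZP (f c - f' c).

(* action of g^-1 on H^1 by conjugation *)
Definition act_inv (c : cochain) : cochain := fun s => map_pt gi (c (g \o s \o gi)).

(* multiplication by T = gamma - 1, where (gamma f)(c) = f(gamma^-1 c) *)
Definition T_act (f : cochain -> K) : cochain -> K := fun c => f (act_inv c) - f c.

Definition Lambda : set (nat -> K) := [set a | forall n, ZP (a n)].

(* f' = a.f; the sum over n is finite modulo Z_p on each element of Sel *)
Definition is_scaled (a : nat -> K) (f f' : cochain -> K) : Prop :=
  forall c, Sel c -> exists n0 : nat, forall n : nat, (n0 <= n)%N ->
    ZP (f' c - \sum_(k < n) a k * iter k T_act f c).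

(* Equality in the direct sum of the Lambda/(D i); elements are families of
   power series *)
Definition sum_mem k (y : 'I_k -> nat -> K) : Prop := forall i, Lambda (y i).
Definition sum_eq k (D y z : 'I_k -> nat -> K) : Prop :=
  forall i, exists2 q, Lambda q & ps_sub (y i) (z i) = ps_mul q (D i).

(* The dual of Sel is pseudo-isomorphic to the direct sum of the Lambda/(D i):
   there is a Lambda-linear map with finite kernel and finite cokernel. *)
Definition pseudo_iso k (D : 'I_k -> nat -> K) : Prop :=
  exists h : (cochain -> K) -> 'I_k -> nat -> K,
    [/\ forall f, dual_Sel f -> sum_mem (h f),
        forall f f', dual_Sel f -> dual_Sel f' -> dual_eq f f' -> sum_eq D (h f) (h f'),
        (forall f f', dual_Sel f -> dual_Sel f' ->
           sum_eq D (h (fun c => f c + f' c)) (fun i => ps_add (h f i) (h f' i))) /\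
        (forall a f f', Lambda a -> dual_Sel f -> dual_Sel f' -> is_scaled a f f' ->
           sum_eq D (h f') (fun i => ps_mul a (h f i))),
        exists (N : nat) (u : 'I_N -> cochain -> K),
          forall f, dual_Sel f -> sum_eq D (h f) (fun=> psC 0) -> exists i, dual_eq f (u i) &
        exists (N : nat) (z : 'I_N -> 'I_k -> nat -> K),
          forall y, sum_mem y -> exists (i : 'I_N) f, dual_Sel f /\
            sum_eq D y (fun l => ps_add (h f l) (z i l))].

Definition distinguished (h : {poly K}) : Prop :=
  h \is monic /\ forall i, (i < (size h).-1)%N -> Qp K h`_i /\ vge h`_i 1.

(* The dual of Sel is pseudo-isomorphic to the direct sum of the Lambda/(p^m),
   m in ms, and of the Lambda/(h), h in hs. *)
Definition Sel_structure (ms : seq nat) (hs : seq {poly K}) : Prop :=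
  [/\ all (fun m => 0 < m)%N ms,
      forall h, h \in hs -> distinguished h &
      let ds : seq {poly K} := [seq (p ^ m)%:R | m <- ms] ++ hs in
      pseudo_iso (fun (i : 'I_(size ds)) (n : nat) => (ds`_i)`_n)].

End Selmer.

Arguments Sel_structure : clear implicits.

Definition char_elt (K : fieldType) (p : nat) (ms : seq nat) (hs : seq {poly K}) : {poly K} :=
  (p ^ sumn ms)%:R * \prod_(h <- hs) h.
Definition mu_inv (ms : seq nat) : nat := sumn ms.
Definition lambda_inv (K : fieldType) (hs : seq {poly K}) : nat :=
  \sum_(h <- hs) (size h).-1.

Section Regulator.
Variables (Qbar : forall l : prime_number, padic_closure l).
Variables (E : elliptic_curve) (p : prime_number).

Let K : padic_closure p := Qbar p.

(* D = Q_p omega + Q_p eta, as row vectors of coordinates *)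
Definition om : 'rV[K]_2 := delta_mx 0 0.
Definition bracket (u v : 'rV[K]_2) : K := u 0 0 * v 0 1 - u 0 1 * v 0 0.
Definition inD (u : 'rV[K]_2) : Prop := forall i, Qp K (u 0 i).

(* Crystalline Frobenius F on D for E supersingular at p, via formal groups
   (Katz): the class of a differential is determined by its integral, a Laurent
   series in t modulo series with bounded coefficients, and F is induced by the
   lift of Frobenius t |-> t^p. Row i of A holds the coordinates of the image
   of the i-th basis vector. Finitely many coefficients, such as the polar
   part, do not affect boundedness. *)
Definition basis_int (i : 'I_2) : nat -> K :=
  if i == 0 then @log_ser E K else @eta_int_ser E K.

Definition is_frobenius (A : 'M[K]_2) : Prop :=
  (forall i k, Qp K (A i k)) /\
  forall i, exists B : nat, forall m : nat,
    vge ((if (p %| m)%N then basis_int i (m %/ p)%N else 0)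
         - \sum_k A i k * basis_int k m) (- B%:R).

(* phi = p^-1 F acts by right multiplication *)
Definition phi_mx (A : 'M[K]_2) : 'M[K]_2 := (p%:R)^-1 *: A.

(* p-adic logarithm of a unit u: log(u^(p-1)) / (p-1) *)
Definition is_logp (u l : K) : Prop :=
  Zp_unit u /\
  ps_eval (fun n => if n is m.+1 then (-1) ^+ m / n%:R else 0)
          (u ^+ p.-1 - 1) (p.-1%:R * l).

(* h extends quadratically to E(Q) the function given by the relation ph on the
   nontorsion points (x, y) that are close to the identity at p (i.e. v_p(x) is
   very negative) and have nonsingular reduction everywhere *)
Definition is_height (ph : rat -> rat -> K -> Prop) (h : point rat -> K) : Prop :=
  (forall (n : int) P, E_ E P -> h (pt_mulz E n P) = n%:~R ^+ 2 * h P) /\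
  exists N : nat, forall x y : rat,
    E_ E (Some (x, y)) -> ~ torsion E (Some (x, y)) ->
    x != 0 -> pc_val (ratr x : K) <= - N%:R ->
    (forall l : prime_number,
       E0 E (map_pt (ratr : rat -> Qbar l) (Some (x, y)))) ->
    ph x y (h (Some (x, y))).

Definition t_param (x y : rat) : K := ratr (- x / y).

Definition is_h_omega (h : point rat -> K) : Prop :=
  is_height (fun x y z => exists2 l, ps_eval (@log_ser E K) (t_param x y) l &
                                     z = - l ^+ 2) h.

(* e is the positive square root of the denominator of x *)
Definition is_h_eta (h : point rat -> K) : Prop :=
  exists2 sg, is_sigma E sg &
  is_height (fun x y z => exists e s l,
    [/\ (e ^ 2)%:Z = denq x, ps_eval sg (t_param x y) s,
        is_logp (s / e%:R) l & z = 2 * l]) h.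

Definition pairing (h : point rat -> K) (P Q : point rat) : K :=
  (h (pt_add E P Q) - h P - h Q) / 2.

Definition reg_det (r : nat) (B : 'I_r -> point rat) (h : point rat -> K) : K :=
  \det (\matrix_(i < r, k < r) pairing h (B i) (B k)).

Definition is_Reg (r : nat) (reg : 'rV[K]_2) : Prop :=
  inD reg /\
  exists (B : 'I_r -> point rat) ho he,
    [/\ mw_basis E B, is_h_omega ho, is_h_eta he &
      forall nu, inD nu -> bracket om nu != 0 ->
        bracket reg nu =
          reg_det B (fun P => nu 0 0 * ho P + nu 0 1 * he P) / bracket om nu ^+ r.-1].

Definition are_signed_regulators (r : nat) (Rplus Rminus : K) : Prop :=
  [/\ Qp K Rplus, Qp K Rminus &
   exists A reg, [/\ is_frobenius A, is_Reg r reg &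
    reg *m (1%:M - phi_mx A) *m (1%:M - phi_mx A)
      = ((p%:R)^-1 * Rplus) *: om - Rminus *: (om *m phi_mx A)]].

(* R_p^{+-}(E/Q), in the representative defined without extra units *)
Definition signed_regulator (r : nat) (e : sign) : K :=
  xget 0 [set R | exists Rplus Rminus, are_signed_regulators r Rplus Rminus /\
                    R = match e with Plus => Rplus | Minus => Rminus end].

End Regulator.

Section Main.
Variables (R : realType) (Qbar : forall l : prime_number, padic_closure l).
Variable (E : elliptic_curve).

Definition tamagawa_product : nat :=
  \big[muln/1%N]_(l \in Sbad E) tamagawa E (Qbar l).

Definition padic_BSD (r : nat) (e : sign) (g gi : prime_number -> algC -> algC) : Prop :=
  forall p : prime_number, odd p -> Sss E p -> a_ E p = 0 ->
  forall ms hs, Sel_structure Qbar E p e (g p) (gi p) ms hs ->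
  exists q : nat -> Qbar p,
    [/\ Lambda q,
        (fun n => (char_elt p ms hs)`_n) = ps_mul (psX _ r) q &
        up_to_unit (q 0%N)
          (signed_regulator Qbar E p r e / p%:R ^+ r
           * (card (Sha_p R Qbar E p))%:R * tamagawa_product%:R)].

Definition Sigma_anom : set prime_number :=
  [set p : prime_number | Sord E p /\ (p %| num_points E p)%N].

Definition Sigma' : set prime_number :=
  [set p : prime_number | [\/ p = 2%N :> nat, (p %| card (Sha R Qbar E))%N | (p %| tamagawa_product)%N]].

Definition Pi_ (r : nat) (e : sign) : set prime_number :=
  [set p : prime_number | Sss E p /\ vge (signed_regulator Qbar E p r e / p%:R ^+ r) 1].

End Main.

(* Main.v *)
Require Import Defs.
From HB Require Import structures.
From mathcomp Require Import all_boot all_order all_algebra all_field.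
From mathcomp Require Import all_classical all_reals.
From mathcomp Require Import finmap complex ring.

Set Implicit Arguments.
Unset Strict Implicit.
Unset Printing Implicit Defensive.

Import Order.TTheory GRing.Theory Num.Theory.

Local Open Scope classical_set_scope.
Local Open Scope ring_scope.

(** Write f = p^mu * g for the characteristic element, g being a product of
    distinguished polynomials, hence monic and congruent to X^lambda modulo p.
    The conjecture gives f = T^r q with q(0) equal, up to a unit, to rho * s * t,
    where rho = R_p / p^r, s is the order of the p-primary part of Sha, and t is
    the product of the Tamagawa numbers. If q(0) is a unit, then the coefficient
    of T^r in f is a unit: so mu = 0 and, as g = X^lambda modulo p, lambda = r
    ([char_elt_unit]); a monic polynomial of degree r divisible by T^r is T^r.

    The number q(0) is p-integral, so it is enough that its valuation be at
    most 0. By hypothesis rho is nonzero with valuation less than 1; it is a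
    p-adic number, whose valuation is an integer ([Qp_val_int]), so the valuation
    is at most 0. The factor t is prime to p by hypothesis. The hypothesis on
    Sha says that p does not divide the order of the whole group, and one has to
    deduce that p does not divide the order of its p-primary part. This is
    Lagrange's theorem, in a group whose elements are classes of cocycles with
    values in E(Qbar): it rests on the group law of the curve.

    The group law ([pt_addA]) is proved for a smooth Weierstrass curve over any
    field. Chords and tangents are treated together through the equations that
    their slope satisfies ([slope]). If t, m are the slopes of the lines PQ and QR
    and t != m, then with k = (x(P) - x(R)) / (t - m) the line through P + Q and R
    has slope k - t - a1, and by symmetry the one through P and Q + R has slope
    k - m - a1 ([slope_third]); the third points of these two lines coincide.
    If t = m the three points are on one line, so P = R or P + Q + R = 0. The cases
    in which two summands are opposite follow from (P + Q) - Q = P ([pt_addK]),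
    the only place where smoothness enters.

    Since automorphisms of the field act additively on points, cocycles,
    coboundaries and local triviality are compatible with differences, and the
    classes of p-power order form a subgroup ([card_Sha_p_dvd]). *)

(** * Valuations on an algebraic closure of the p-adic numbers *)

Section Valuation.
Variables (p : nat) (K : padic_closure p).
Hypothesis p_pr : prime p.
Implicit Types (x y : K) (n : rat).

Local Notation v := (@pc_val p K).

Lemma natr_pc_eq0 (m : nat) : (m%:R == 0 :> K) = (m == 0)%N.
Proof. by have /pcharf0P -> := @pc_char0 p K. Qed.

Lemma intr_pc_eq0 (z : int) : (z%:~R == 0 :> K) = (z == 0).
Proof. by case: z => k; rewrite /intmul ?oppr_eq0 natr_pc_eq0. Qed.

Lemma pc_val1 : v 1 = 0.
Proof.
have /eqP := pc_valM (oner_neq0 K) (oner_neq0 K).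
by rewrite mulr1 -subr_eq0 opprD addrA subrr sub0r oppr_eq0 => /eqP.
Qed.

Lemma pc_valN x : v (- x) = v x.
Proof.
have [-> | nx] := eqVneq x 0; first by rewrite oppr0.
have n1 : - 1 != 0 :> K by rewrite oppr_eq0 oner_neq0.
have := pc_valM n1 n1; rewrite mulrNN mulr1 pc_val1 -mulr2n => /esym/eqP.
rewrite mulrn_eq0 /= => /eqP v1.
by rewrite -mulN1r pc_valM // v1 add0r.
Qed.

Lemma pc_valV x : x != 0 -> v x^-1 = - v x.
Proof.
move=> nx; apply/eqP; rewrite -addr_eq0 addrC -pc_valM ?invr_eq0 //.
by rewrite mulfV // pc_val1.
Qed.

Lemma vge_add x y n : vge x n -> vge y n -> vge (x + y) n.
Proof.
move=> [-> | hx]; first by rewrite add0r.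
move=> [-> | hy]; first by rewrite addr0; right.
have [-> | nx] := eqVneq x 0; first by rewrite add0r; right.
have [-> | ny] := eqVneq y 0; first by rewrite addr0; right.
have [-> | nxy] := eqVneq (x + y) 0; first by left.
by right; apply: le_trans (pc_valD nx ny nxy); rewrite le_min hx.
Qed.

Lemma vge_opp x n : vge x n -> vge (- x) n.
Proof. by move=> [->|h]; [left; rewrite oppr0 | right; rewrite pc_valN]. Qed.

Lemma vge_mul x y m n : vge x m -> vge y n -> vge (x * y) (m + n).
Proof.
move=> [-> | hx]; first by left; rewrite mul0r.
move=> [-> | hy]; first by left; rewrite mulr0.
have [-> | nx] := eqVneq x 0; first by left; rewrite mul0r.
have [-> | ny] := eqVneq y 0; first by left; rewrite mulr0.
by right; rewrite pc_valM // lerD.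
Qed.

Lemma vge_le x m n : m <= n -> vge x n -> vge x m.
Proof. by move=> mn [->|h]; [left | right; apply: le_trans h]. Qed.

Lemma vge_val x n : x != 0 -> vge x n -> n <= v x.
Proof. by move=> nx [e|//]; rewrite e eqxx in nx. Qed.

Lemma vge_sum (I : Type) (s : seq I) (P : pred I) (F : I -> K) n :
  (forall i, P i -> vge (F i) n) -> vge (\sum_(i <- s | P i) F i) n.
Proof.
move=> h; elim/big_rec: _ => [|i x Pi hx]; first by left.
by apply: vge_add => //; apply: h.
Qed.

Lemma vge_nat m : vge (m%:R : K) 0.
Proof.
elim: m => [|m IHm]; first by left.
by rewrite -addn1 natrD; apply: vge_add => //; right; rewrite pc_val1.
Qed.

(** A Bezout relation 1 = a p - b m shows that m cannot have positive
    valuation together with p. *)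
Lemma pc_val_coprime m : coprime p m -> v m%:R = 0.
Proof.
move=> co; have nm : m%:R != 0 :> K.
  rewrite natr_pc_eq0; apply: contraTneq co => ->.
  by rewrite /coprime gcdn0; apply: contraTneq p_pr => ->.
apply/le_anti/andP; split; last exact: vge_val (vge_nat m).
rewrite leNgt; apply/negP => vm.
have vge_mulr x (a : nat) n : vge x n -> vge (a%:R * x) n.
  by move=> hx; rewrite -[n]add0r; apply: vge_mul => //; apply: vge_nat.
case: (egcdnP m (prime_gt0 p_pr)) => a b; rewrite (eqP co) => e _.
have : vge (1 : K) (Num.min 1 (v m%:R)).
  rewrite [X in vge X](_ : 1 = a%:R * p%:R + - (b%:R * m%:R)); last first.
    by rewrite -!natrM e natrD addrAC subrr add0r.
  apply: vge_add; last apply: vge_opp; apply: vge_mulr; right.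
    by rewrite pc_valp ge_min lexx.
  by rewrite ge_min lexx orbT.
move/(vge_val (oner_neq0 K)); rewrite pc_val1 leNgt => /negP; apply.
by rewrite lt_min vm ltr01.
Qed.

Lemma pc_val_expp i : v (p ^ i)%:R = i%:R.
Proof.
have np j : (p ^ j)%:R != 0 :> K.
  by rewrite natr_pc_eq0 -lt0n expn_gt0 prime_gt0.
elim: i => [|i IHi]; first by rewrite expn0 pc_val1.
by rewrite expnS natrM pc_valM ?np ?(np 1%N) // IHi pc_valp -natr1 addrC.
Qed.

(** A nonzero limit of rational numbers has the same valuation as the rational
    numbers close to it. *)
Lemma Qp_val_int x : Qp K x -> x != 0 -> exists z : int, v x = z%:~R.
Proof.
have valn (m : nat) : (0 < m)%N -> v m%:R = (logn p m)%:R.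
  move=> m0; have := pfactor_coprime p_pr m0 => -[k co e].
  have k0 : (0 < k)%N by case: k e {co} => // e; rewrite e in m0.
  have nk : k%:R != 0 :> K by rewrite natr_pc_eq0 -lt0n.
  have np : (p ^ logn p m)%:R != 0 :> K.
    by rewrite natr_pc_eq0 -lt0n expn_gt0 prime_gt0.
  by rewrite {1}e natrM pc_valM // pc_val_expp pc_val_coprime // add0r.
have valz (z : int) : z != 0 -> exists m : nat, v z%:~R = m%:R.
  move=> nz; exists (logn p `|z|%N); rewrite -valn ?absz_gt0 //.
  case: z nz => m _ //; rewrite NegzE rmorphN /= pc_valN //.
move=> /= Qx nx.
have [N hN] : exists N : nat, v x < N%:R.
  by exists (Num.truncn (v x)).+1; apply: truncnS_gt.
have [a [q _ <-{a}]] := Qx N => hxq.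
have [-> nq] : v x = v (ratr q) /\ ratr q != 0 :> K.
  have [<- // | ne] := eqVneq x (ratr q).
  have nd : x - ratr q != 0 by rewrite subr_eq0.
  have vN : v x < v (x - ratr q) := lt_le_trans hN (vge_val nd hxq).
  have nq : ratr q != 0 :> K.
    by apply: contraTneq vN => ->; rewrite subr0 ltxx.
  split=> //; apply/le_anti/andP; split; last first.
    have := pc_valD nq nd; rewrite addrC subrK => /(_ nx).
    by rewrite ge_min [v (x - _) <= _]leNgt vN orbF.
  have nd' : - (x - ratr q) != 0 by rewrite oppr_eq0.
  have := pc_valD nx nd'; rewrite subKr pc_valN => /(_ nq) h.
  by apply: le_trans h; rewrite le_min lexx ltW.
have nq' : q != 0 by apply: contraNneq nq => ->; rewrite /ratr mul0r.
have [m em] : exists m : nat, v (numq q)%:~R = m%:R by apply: valz; rewrite numq_eq0.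
have [d ed] : exists d : nat, v (denq q)%:~R = d%:R by apply: valz; apply: denq_neq0.
exists (m%:Z - d%:Z).
rewrite /ratr pc_valM ?invr_eq0 ?intr_pc_eq0 ?numq_eq0 ?denq_neq0 //.
rewrite pc_valV ?intr_pc_eq0 ?denq_neq0 //.
by rewrite em ed rmorphB.
Qed.

End Valuation.

(** * The characteristic element *)

(** A distinguished polynomial of degree n is a monic polynomial congruent to
    X^n modulo p, a form that is stable under products. *)
Lemma distinguished_prod (p : prime_number)
    (Qbar : forall l : prime_number, padic_closure l) (hs : seq {poly Qbar p}) :
  (forall h, h \in hs -> distinguished h) ->
  let g := \prod_(h <- hs) h in
  [/\ g \is monic, size g = (lambda_inv hs).+1 &
      forall i, vge (g - 'X^(lambda_inv hs))`_i 1].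
Proof.
elim: hs => [|h hs IHhs] hd /=.
  rewrite /lambda_inv !big_nil expr0 subrr monic1 size_poly1; split=> // i.
  by left; rewrite coef0.
have [hm hc] : distinguished h by apply: hd; rewrite mem_head.
have [] := IHhs; first by move=> k hk; apply: hd; rewrite inE hk orbT.
rewrite /lambda_inv !big_cons -/(lambda_inv hs); set g := \prod_(_ <- _) _.
move=> gm gs gc; set N := lambda_inv hs in gs gc *.
have hs0 : size h = (size h).-1.+1.
  by rewrite prednK // lt0n size_poly_eq0 monic_neq0.
set n := (size h).-1 in hs0 hc *.
have hc' i : vge (h - 'X^n)`_i 1.
  rewrite coefB coefXn; have [lt_in | | ->] := ltngtP i n.
  - by rewrite subr0; have [] := hc i lt_in.
  - by move=> lt_ni; left; rewrite nth_default ?subr0 // hs0.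
  by left; have /monicP := hm; rewrite /lead_coef -/n => ->; rewrite subrr.
have vgeX (k i : nat) : vge ('X^k : {poly Qbar p})`_i 0.
  by rewrite coefXn; apply: vge_nat.
have vgeM (a b : {poly Qbar p}) m1 m2 : (forall i, vge a`_i m1) ->
    (forall i, vge b`_i m2) -> forall i, vge (a * b)`_i (m1 + m2).
  by move=> ha hb i; rewrite coefM; apply: vge_sum => j _; apply: vge_mul.
split; first by rewrite rpredM.
  by rewrite size_monicM ?monic_neq0 // hs0 gs addSn addnS.
move=> i.
have -> : h * g - 'X^(n + N) = (h - 'X^n) * (g - 'X^N) + 'X^n * (g - 'X^N)
    + 'X^N * (h - 'X^n) by rewrite exprD; ring.
rewrite !coefD; apply: vge_add; first apply: vge_add.
- by apply: vge_le (vgeM _ _ _ _ hc' gc i).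
- by rewrite -[1]add0r; apply: vgeM.
- by rewrite -[1]add0r; apply: vgeM.
Qed.

(** The coefficient of X^r in p^mu * g is q(0), which is not divisible by p:
    this excludes mu > 0, and also r != lambda because all the other coefficients
    of g are divisible by p. *)
Lemma char_elt_unit (p : prime_number)
    (Qbar : forall l : prime_number, padic_closure l)
    (ms : seq nat) (hs : seq {poly Qbar p}) (r : nat) (q : nat -> Qbar p) :
  (forall h, h \in hs -> distinguished h) ->
  (fun n => (char_elt p ms hs)`_n) = ps_mul (psX _ r) q ->
  q 0%N != 0 -> pc_val (q 0%N) <= 0 ->
  [/\ char_elt p ms hs = 'X^r, mu_inv ms = 0%N & lambda_inv hs = r].
Proof.
move=> hhs ef nq vq.
have nvq : ~ vge (q 0%N) 1.
  by move=> /(vge_val nq) h; have := le_trans h vq; rewrite ler10.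
have cf i : (char_elt p ms hs)`_i = ps_mul (psX _ r) q i by rewrite -ef.
have cfr : (char_elt p ms hs)`_r = q 0%N.
  rewrite cf /ps_mul big_ord_recr /= /psX eqxx mul1r subnn big1 ?add0r // => i _.
  by rewrite (ltn_eqF (ltn_ord i)) mul0r.
have cfl i : (i < r)%N -> (char_elt p ms hs)`_i = 0.
  move=> ir; rewrite cf /ps_mul big1 // => j _.
  by rewrite /psX (ltn_eqF (leq_ltn_trans _ ir)) ?mul0r // -ltnS.
have [] := distinguished_prod hhs; set g := \prod_(_ <- _) _ => gm gs gc.
have fE : char_elt p ms hs = (p ^ mu_inv ms)%:R * g by [].
have gc0 i : vge g`_i 0.
  rewrite -[g](subrK 'X^(lambda_inv hs)) coefD; apply: vge_add.
    by apply: vge_le (gc i).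
  by rewrite coefXn; apply: vge_nat.
have mu0 : mu_inv ms = 0%N.
  case E : (mu_inv ms) => [//|m]; case: nvq; rewrite -cfr fE E expnS.
  rewrite -polyC_natr mul_polyC coefZ natrM -mulrA.
  apply: vge_le (vge_mul (m := 1) (n := 0) _ _).
  - by rewrite addr0.
  - by right; rewrite pc_valp.
  by apply: vge_le (vge_mul (vge_nat _ _) (gc0 _)); rewrite addr0.
rewrite {}mu0 expn0 mul1r in fE *.
have er : lambda_inv hs = r.
  apply/eqP; rewrite eq_sym; apply: contra_notT nvq => ner.
  by have := gc r; rewrite coefB coefXn (negbTE ner) subr0 -fE cfr.
split=> //; rewrite fE -er; apply/polyP => i; rewrite coefXn.
have [lt_i | lt_i | ->] := ltngtP i (lambda_inv hs).
- by rewrite -fE cfl // -er.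
- by rewrite nth_default // gs.
by have /monicP := gm; rewrite /lead_coef gs.
Qed.

(** * The group law of a Weierstrass curve *)

Section GroupLaw.
Variables (W : weierstrass) (F : fieldType).

Local Notation a1 := ((wa1 W)%:~R : F).
Local Notation a2 := ((wa2 W)%:~R : F).
Local Notation a3 := ((wa3 W)%:~R : F).
Local Notation a4 := ((wa4 W)%:~R : F).
Local Notation a6 := ((wa6 W)%:~R : F).
Local Notation "P +e Q" := (pt_add W P Q) (at level 50, left associativity).
Local Notation neg := (@pt_neg W F).

Definition opposite (x1 y1 x2 y2 : F) : bool :=
  (x1 == x2) && (y1 + y2 + a1 * x2 + a3 == 0).

(** For distinct x-coordinates the second equation is the difference of the
    two equations of the curve, divided by x2 - x1. For equal points the first
    equation is void, and the second one says that t is the slope of the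
    tangent. Unless the points are opposite, the two together determine t. *)
Definition slope (x1 y1 x2 y2 t : F) : Prop :=
  y2 - y1 = t * (x2 - x1) /\
  t * (y1 + y2 + a1 * x2 + a3) =
    x1 ^+ 2 + x1 * x2 + x2 ^+ 2 + a2 * (x1 + x2) + a4 - a1 * y1.

(** Coordinates of the opposite of the third intersection of the curve with a
    line of slope t. *)
Definition third_x (x1 x2 t : F) : F := t ^+ 2 + a1 * t - a2 - x1 - x2.
Definition third_y (x1 y1 x2 t : F) : F :=
  - (t + a1) * third_x x1 x2 t - (y1 - t * x1) - a3.

Lemma slopeP x1 y1 x2 y2 :
  on_curve W (Some (x1, y1)) -> on_curve W (Some (x2, y2)) ->
  ~~ opposite x1 y1 x2 y2 -> exists t, slope x1 y1 x2 y2 t.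
Proof.
move=> /eqP h1 /eqP h2; rewrite negb_and.
have [ex | nx _] := eqVneq x1 x2.
  rewrite -{}ex in h2 *; rewrite orFb => nz.
  have e : y2 = y1.
    apply/eqP; rewrite -subr_eq0; have /eqP := h2; rewrite -h1 -subr_eq0.
    have -> : y2 ^+ 2 + a1 * x1 * y2 + a3 * y2 - (y1 ^+ 2 + a1 * x1 * y1 + a3 * y1) =
      (y2 - y1) * (y1 + y2 + a1 * x1 + a3) by ring.
    by rewrite mulf_eq0 (negbTE nz) orbF.
  rewrite e in nz *.
  exists ((3 * x1 ^+ 2 + 2 * a2 * x1 + a4 - a1 * y1) / (y1 + y1 + a1 * x1 + a3)).
  by split; [ring | rewrite mulfVK //; ring].
have nx' : x2 - x1 != 0 by rewrite subr_eq0 eq_sym.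
exists ((y2 - y1) / (x2 - x1)); split; first by rewrite mulfVK.
apply: (mulfI nx'); rewrite mulrA mulrCA mulfV // mulr1.
have e6 : a6 = y1 ^+ 2 + a1 * x1 * y1 + a3 * y1 - (x1 ^+ 3 + a2 * x1 ^+ 2 + a4 * x1).
  by rewrite h1; ring.
have /eqP := h2; rewrite e6 -subr_eq0 => /eqP e.
apply/eqP; rewrite -subr_eq0 -e; apply/eqP; ring.
Qed.

Lemma slope_sym x1 y1 x2 y2 t : slope x1 y1 x2 y2 t -> slope x2 y2 x1 y1 t.
Proof.
move=> [h1 h2]; split; first by rewrite -opprB h1; ring.
have e : y2 = y1 + t * (x2 - x1) by rewrite -h1; ring.
transitivity (t * (y1 + y2 + a1 * x2 + a3) - t * (x2 - x1) * a1); first by ring.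
by rewrite h2 e; ring.
Qed.

Lemma opposite_sym x1 y1 x2 y2 : opposite x1 y1 x2 y2 = opposite x2 y2 x1 y1.
Proof.
rewrite /opposite eq_sym; have [-> | //] := eqVneq x2 x1.
by rewrite (addrC y1).
Qed.

Lemma pt_add_opposite x1 y1 x2 y2 : opposite x1 y1 x2 y2 ->
  Some (x1, y1) +e Some (x2, y2) = None.
Proof. by rewrite /opposite /= => ->. Qed.

Lemma pt_add_slope x1 y1 x2 y2 t :
  ~~ opposite x1 y1 x2 y2 -> slope x1 y1 x2 y2 t ->
  Some (x1, y1) +e Some (x2, y2) = Some (third_x x1 x2 t, third_y x1 y1 x2 t).
Proof.
rewrite /opposite => no [h1 h2]; rewrite /= (negbTE no).
set u := (if x1 == x2 then _ else _).
have -> // : u = t.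
rewrite /u; move: no; have [e | nx _] := eqVneq x1 x2.
  move: h1 h2; rewrite -e subrr mulr0 => /subr0_eq -> h2 /= nz.
  have e2y : 2 * y1 = y1 + y1 by ring.
  by apply: (canLR (mulfK _)); rewrite e2y // h2; ring.
by rewrite h1 mulfK // subr_eq0 eq_sym.
Qed.

Lemma opposite_neg x y : opposite x y x (- y - a1 * x - a3).
Proof. by rewrite /opposite eqxx /=; apply/eqP; ring. Qed.

Lemma oppositeP x1 y1 x2 y2 :
  reflect (Some (x2, y2) = neg (Some (x1, y1))) (opposite x1 y1 x2 y2).
Proof.
apply: (iffP andP) => [[/eqP-> /eqP h] | [-> ->]].
  by congr (Some (_, _)); apply/eqP; rewrite -subr_eq0 -h; apply/eqP; ring.
by split=> //; apply/eqP; ring.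
Qed.

Lemma pt_negK (P : Defs.point F) : neg (neg P) = P.
Proof. by case: P => [[x y]|//]; congr (Some (_, _)); ring. Qed.

Lemma pt_addN (P : Defs.point F) : P +e (neg P) = None.
Proof. by case: P => [[x y]|//]; apply/pt_add_opposite/opposite_neg. Qed.

Lemma on_curve_neg (P : Defs.point F) : on_curve W P -> on_curve W (neg P).
Proof. by case: P => [[x y]|//] /eqP h; apply/eqP; rewrite -h; ring. Qed.

Lemma pt_addC (P Q : Defs.point F) : on_curve W P -> on_curve W Q -> P +e Q = Q +e P.
Proof.
case: P Q => [[x1 y1]|] [[x2 y2]|] // h1 h2.
have [o | no] := boolP (opposite x1 y1 x2 y2).
  by rewrite !pt_add_opposite // opposite_sym.
have [t ht] := slopeP h1 h2 no.
rewrite (pt_add_slope no ht) (pt_add_slope _ (slope_sym ht)) 1?opposite_sym //.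
have [e _] := ht.
have {}e : y2 = y1 + t * (x2 - x1) by rewrite -e; ring.
by congr (Some (_, _)); rewrite /third_y /third_x ?e; ring.
Qed.

Lemma on_curve_add (P Q : Defs.point F) :
  on_curve W P -> on_curve W Q -> on_curve W (P +e Q).
Proof.
case: P Q => [[x1 y1]|] [[x2 y2]|] // h1 h2.
have [o | no] := boolP (opposite x1 y1 x2 y2); first by rewrite pt_add_opposite.
have [t ht] := slopeP h1 h2 no; rewrite (pt_add_slope no ht).
have [e1 e2] := ht; move/eqP: h1 => h1.
have ey : y2 = y1 + t * (x2 - x1) by rewrite -e1; ring.
apply/eqP; rewrite /third_y /third_x.
have e6 : a6 = y1 ^+ 2 + a1 * x1 * y1 + a3 * y1 - (x1 ^+ 3 + a2 * x1 ^+ 2 + a4 * x1).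
  by rewrite h1; ring.
have e4 : a4 = t * (y1 + y2 + a1 * x2 + a3) -
    (x1 ^+ 2 + x1 * x2 + x2 ^+ 2 + a2 * (x1 + x2) - a1 * y1) by rewrite e2; ring.
by rewrite e6 e4 ey; ring.
Qed.

Lemma on_curve_sub (P Q : Defs.point F) :
  on_curve W P -> on_curve W Q -> on_curve W (pt_sub W P Q).
Proof. by move=> hP hQ; apply: on_curve_add => //; apply: on_curve_neg. Qed.

Lemma on_curve_muln n (P : Defs.point F) : on_curve W P -> on_curve W (pt_muln W n P).
Proof. by move=> hP; elim: n => //= n IHn; apply: on_curve_add. Qed.

Lemma pt_negD (P Q : Defs.point F) : on_curve W P -> on_curve W Q ->
  neg (P +e Q) = (neg P) +e (neg Q).
Proof.
case: P Q => [[x1 y1]|] [[x2 y2]|] // h1 h2.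
have no' : opposite x1 (- y1 - a1 * x1 - a3) x2 (- y2 - a1 * x2 - a3) =
           opposite x1 y1 x2 y2.
  rewrite /opposite; have [-> /= | //] := eqVneq x1 x2.
  by rewrite -oppr_eq0; congr (_ == 0); ring.
have [o | no] := boolP (opposite x1 y1 x2 y2).
  by rewrite !pt_add_opposite ?no'.
have [t ht] := slopeP h1 h2 no.
have ht' : slope x1 (- y1 - a1 * x1 - a3) x2 (- y2 - a1 * x2 - a3) (- t - a1).
  have [e1 e2] := ht.
  have ey : y2 = y1 + t * (x2 - x1) by rewrite -e1; ring.
  have e4 : a4 = t * (y1 + y2 + a1 * x2 + a3) -
    (x1 ^+ 2 + x1 * x2 + x2 ^+ 2 + a2 * (x1 + x2) - a1 * y1) by rewrite e2; ring.
  by split; rewrite ?e4 ey; ring.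
rewrite (pt_add_slope no ht) [RHS](pt_add_slope _ ht') ?no' //.
by congr (Some (_, _)); rewrite /third_y /third_x; ring.
Qed.

(** At a singular point the vanishing of the equation and of its two
    derivatives expresses a3, a4 and a6 through a1, a2, x and y; the discriminant
    is identically zero after this substitution, in every characteristic. *)
Lemma disc_singular x y : on_curve W (Some (x, y)) ->
  2 * y + a1 * x + a3 = 0 ->
  3 * x ^+ 2 + 2 * a2 * x + a4 - a1 * y = 0 -> (disc W)%:~R = 0 :> F.
Proof.
case: W => b1 b2 b3 b4 b6 /= /eqP h hy hx.
have e3 : b3%:~R = - (2 * y + b1%:~R * x) :> F.
  by apply/eqP; rewrite -subr_eq0 -hy; apply/eqP; ring.
have e4 : b4%:~R = - (3 * x ^+ 2 + 2 * b2%:~R * x - b1%:~R * y) :> F.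
  by apply/eqP; rewrite -subr_eq0 -hx; apply/eqP; ring.
have e6 : b6%:~R = y ^+ 2 + b1%:~R * x * y + b3%:~R * y -
    (x ^+ 3 + b2%:~R * x ^+ 2 + b4%:~R * x) :> F by rewrite h; ring.
rewrite !(rmorphD, rmorphN, rmorphM, rmorphXn) /=.
by rewrite e6 e4 e3; ring.
Qed.

Hypothesis smooth : (disc W)%:~R != 0 :> F.

(** If P + Q = Q, then the line PQ contains -Q besides Q, so Q = -Q and the
    line meets the curve twice at Q. The derivative in y vanishes at Q as
    Q = -Q, and the slope equation then gives the vanishing of the derivative in x:
    the curve would be singular. *)
Lemma third_neq x1 y1 x2 y2 t :
  on_curve W (Some (x2, y2)) -> slope x1 y1 x2 y2 t ->
  third_x x1 x2 t = x2 -> third_y x1 y1 x2 t = y2 -> False.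
Proof.
move=> h2 [e1 e2] ex ey.
have ey1 : y1 = y2 - t * (x2 - x1) by rewrite -e1; ring.
have ex1 : x1 = t ^+ 2 + a1 * t - a2 - x2 - x2.
  by rewrite -[in X in _ - X]ex /third_x; ring.
have hy : 2 * y2 + a1 * x2 + a3 = 0.
  by rewrite [2]/(1 + 1) mulrDl mul1r -[X in X + _ + _ + _]ey /third_y ex ey1; ring.
apply/negP: smooth; rewrite negbK; apply/eqP; apply: (disc_singular h2 hy).
have -> : 3 * x2 ^+ 2 + 2 * a2 * x2 + a4 - a1 * y2 =
    x1 ^+ 2 + x1 * x2 + x2 ^+ 2 + a2 * (x1 + x2) + a4 - a1 * y1 -
    t * (y1 + y2 + a1 * x2 + a3).
  have -> : a3 = - (2 * y2 + a1 * x2).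
    by apply/eqP; rewrite -subr_eq0 -hy; apply/eqP; ring.
  by rewrite ey1 ex1; ring.
by rewrite e2 subrr.
Qed.

(** Reflecting the line PQ, which has slope t, gives a line of slope
    - t - a1 through P + Q, -Q and -P. *)
Lemma pt_addK (P Q : Defs.point F) : on_curve W P -> on_curve W Q ->
  (P +e Q) +e (neg Q) = P.
Proof.
case: P Q => [[x1 y1]|] [[x2 y2]|] // h1 h2; last first.
  exact: (pt_addN (Some (x2, y2))).
have [o | no] := boolP (opposite x1 y1 x2 y2).
  rewrite pt_add_opposite //; rewrite opposite_sym in o.
  by move/oppositeP: o => <-.
have [t ht] := slopeP h1 h2 no; rewrite (pt_add_slope no ht).
set x3 := third_x x1 x2 t; set y3 := third_y x1 y1 x2 t.
have no' : ~~ opposite x3 y3 x2 (- y2 - a1 * x2 - a3).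
  apply/negP => /andP[/eqP ex /eqP ey].
  apply: (third_neq h2 ht ex).
  by apply/eqP; rewrite -subr_eq0 -ey; apply/eqP; rewrite /y3; ring.
have [e1 e2] := ht.
have ey : y2 = y1 + t * (x2 - x1) by rewrite -e1; ring.
have e4 : a4 = t * (y1 + y2 + a1 * x2 + a3) -
    (x1 ^+ 2 + x1 * x2 + x2 ^+ 2 + a2 * (x1 + x2) - a1 * y1) by rewrite e2; ring.
have ht' : slope x3 y3 x2 (- y2 - a1 * x2 - a3) (- t - a1).
  by split; rewrite ?e4 ey /y3 /x3 /third_y /third_x; ring.
rewrite [LHS](pt_add_slope no' ht').
by congr (Some (_, _)); rewrite /y3 /x3 /third_y /third_x; ring.
Qed.

(** The difference of the slope equations of PQ and QR is divisible by t - m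
    once x1 - x3 is written k (t - m), and what remains is a relation linear in a3.
    It turns the identities below into polynomial identities in free variables. *)
Lemma slopes_a3 x1 y1 x2 y2 x3 y3 t m k :
  slope x1 y1 x2 y2 t -> slope x2 y2 x3 y3 m ->
  x1 - x3 = k * (t - m) -> t - m != 0 ->
  a3 = k * (x1 + x2 + x3 + a2 - t ^+ 2 - a1 * t)
       - (t + m + a1) * (x3 - x2) - a1 * x2 - y2 *+ 2.
Proof.
move=> [h1 h2] [h3 h4] h5 nz.
have ex1 : x1 = x3 + k * (t - m) by rewrite -h5; ring.
have ey1 : y1 = y2 - t * (x2 - x1) by rewrite -h1; ring.
have ey3 : y3 = y2 + m * (x3 - x2) by rewrite -h3; ring.
apply: (mulfI nz); apply/eqP; rewrite -subr_eq0; apply/eqP.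
transitivity (t * (y1 + y2 + a1 * x2 + a3)
    - (x1 ^+ 2 + x1 * x2 + x2 ^+ 2 + a2 * (x1 + x2) + a4 - a1 * y1)
    - (m * (y2 + y3 + a1 * x3 + a3)
       - (x2 ^+ 2 + x2 * x3 + x3 ^+ 2 + a2 * (x2 + x3) + a4 - a1 * y2))).
  by rewrite ey1 ey3 ex1; ring.
by rewrite h2 h4; ring.
Qed.

(** The heart of associativity: the slope of the line through P + Q and R. Since
    k does not change when (P, t) and (R, m) are exchanged, the same lemma gives
    the slope k - m - a1 for P and Q + R. *)
Lemma slope_third x1 y1 x2 y2 x3 y3 t m k :
  slope x1 y1 x2 y2 t -> slope x2 y2 x3 y3 m ->
  x1 - x3 = k * (t - m) -> t - m != 0 ->
  slope (third_x x1 x2 t) (third_y x1 y1 x2 t) x3 y3 (k - t - a1).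
Proof.
move=> ht hm h5 nz; have ea3 := slopes_a3 ht hm h5 nz.
have [h1 h2] := ht; have [h3 h4] := hm.
have ex1 : x1 = x3 + k * (t - m) by rewrite -h5; ring.
have ey1 : y1 = y2 - t * (x2 - x1) by rewrite -h1; ring.
have ey3 : y3 = y2 + m * (x3 - x2) by rewrite -h3; ring.
have ea4 : a4 = t * (y1 + y2 + a1 * x2 + a3) -
  (x1 ^+ 2 + x1 * x2 + x2 ^+ 2 + a2 * (x1 + x2) - a1 * y1) by rewrite h2; ring.
by rewrite /third_y /third_x; split; rewrite ?ea4 ea3 ey1 ey3 ex1; ring.
Qed.

Lemma pt_addNK (P Q : Defs.point F) : on_curve W P -> on_curve W Q ->
  (P +e neg Q) +e Q = P.
Proof. by move=> hP hQ; rewrite -{2}[Q]pt_negK pt_addK // on_curve_neg. Qed.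

(** The cases with two opposite summands are instances of cancellation; the
    others are computed with the slopes of the lines involved. *)
Lemma pt_addA (P Q R : Defs.point F) :
  on_curve W P -> on_curve W Q -> on_curve W R ->
  (P +e Q) +e R = P +e (Q +e R).
Proof.
have add0 X : X +e None = X :> Defs.point F by case: X => [[]|].
move=> hP hQ hR.
case: P hP => [[x1 y1]|] // hP; case: Q hQ => [[x2 y2]|] // hQ.
case: R hR => [[x3 y3]|] hR; last by rewrite !add0.
set P := Some (x1, y1); set Q := Some (x2, y2); set R := Some (x3, y3).
have hNP := on_curve_neg hP; have hNQ := on_curve_neg hQ.
have hNR := on_curve_neg hR.
have [/oppositeP eQ | no12] := boolP (opposite x1 y1 x2 y2).
  rewrite /Q eQ pt_addN (pt_addC hNP hR) (pt_addC hP) ?on_curve_add //.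
  by rewrite pt_addNK.
have [/oppositeP eR | no23] := boolP (opposite x2 y2 x3 y3).
  by rewrite /R eR pt_addK // pt_addN add0.
have [t ht] := slopeP hP hQ no12; have [m hm] := slopeP hQ hR no23.
have eS : P +e Q = _ := pt_add_slope no12 ht.
have eT : Q +e R = _ := pt_add_slope no23 hm.
have hS := on_curve_add hP hQ; have hT := on_curve_add hQ hR.
have [oS | noS] := boolP (opposite (third_x x1 x2 t) (third_y x1 y1 x2 t) x3 y3).
  have -> : R = neg (P +e Q) by rewrite eS; apply/oppositeP.
  rewrite pt_addN pt_negD // (pt_addC hQ) ?on_curve_add //.
  by rewrite pt_addNK // pt_addN.
have [oT | noT] := boolP (opposite x1 y1 (third_x x2 x3 m) (third_y x2 y2 x3 m)).
  have -> : P = neg (Q +e R).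
    by rewrite eT; apply/oppositeP; rewrite opposite_sym.
  rewrite (pt_addC (on_curve_neg hT) hT) pt_addN pt_negD //.
  by rewrite (pt_addC hNQ hNR) pt_addNK // pt_addC // pt_addN.
(* Equal slopes mean that P, Q and R are on one line. *)
have [etm | ntm] := eqVneq t m; last first.
  have nz : t - m != 0 by rewrite subr_eq0.
  set k := (x1 - x3) / (t - m).
  have ek : x1 - x3 = k * (t - m) by rewrite divfK.
  have hu := slope_third ht hm ek nz.
  have ek' : x3 - x1 = k * (m - t) by rewrite -opprB ek; ring.
  have nz' : m - t != 0 by rewrite subr_eq0 eq_sym.
  have := slope_third (slope_sym hm) (slope_sym ht) ek' nz'.
  have e32 : third_x x3 x2 m = third_x x2 x3 m by rewrite /third_x; ring.
  have [e23 _] := hm.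
  have ey3 : y3 = y2 + m * (x3 - x2) by rewrite -e23; ring.
  have e32' : third_y x3 y3 x2 m = third_y x2 y2 x3 m.
    by rewrite /third_y /third_x ey3; ring.
  rewrite e32 e32' => /slope_sym hv.
  rewrite eS eT (pt_add_slope noS hu) (pt_add_slope noT hv).
  have [e12 _] := ht.
  have ey1 : y1 = y2 - t * (x2 - x1) by rewrite -e12; ring.
  have ex1 : x1 = x3 + k * (t - m) by rewrite -ek; ring.
  have ea3 := slopes_a3 ht hm ek nz.
  congr (Some (_, _)); rewrite /third_y /third_x; first by rewrite ex1; ring.
  by rewrite ea3 ey1 ex1; ring.
have [e12 e12'] := ht; have [e23 e23'] := hm.
have ey1 : y1 = y2 - t * (x2 - x1) by rewrite -e12; ring.
have ey3 : y3 = y2 + t * (x3 - x2) by rewrite etm -e23; ring.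
have : (x1 - x3) * (x3 - third_x x1 x2 t) = 0.
  have e4 : a4 = t * (y1 + y2 + a1 * x2 + a3) -
    (x1 ^+ 2 + x1 * x2 + x2 ^+ 2 + a2 * (x1 + x2) - a1 * y1) by rewrite e12'; ring.
  move/eqP: e23'; rewrite -etm -subr_eq0 => /eqP <-.
  by rewrite e4 ey3 ey1 /third_x; ring.
(* Either P = R, and commutativity suffices, or R = -(P + Q), a case that has
   been excluded. *)
move/eqP; rewrite mulf_eq0 !subr_eq0 => /orP[] /eqP ex.
  have -> : R = P by congr (Some (_, _)); rewrite ?ey3 ?ey1 ex //; ring.
  by rewrite pt_addC // (pt_addC hQ hP).
case/negP: noS; rewrite /opposite ex eqxx /=; apply/eqP.
by rewrite /third_y -ex ey3 ey1; ring.
Qed.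

End GroupLaw.

(** * The abelian group of points *)

Section Group.
Variables (W : weierstrass) (F : fieldType).

(** Indexed by the proof of smoothness, so that the group structure can be
    attached to the type. *)
Definition curve_point (smooth : (disc W)%:~R != 0 :> F) : Type :=
  {P : Defs.point F | on_curve W P}.

Variable smooth : (disc W)%:~R != 0 :> F.
Local Notation EF := (curve_point smooth).

HB.instance Definition _ := Choice.on EF.

Definition cpt (P : Defs.point F) (hP : on_curve W P) : EF :=
  exist (fun Q : Defs.point F => on_curve W Q) P hP.
Definition cpt_zero : EF := cpt (isT : on_curve W (None : Defs.point F)).
Definition cpt_opp (P : EF) : EF := cpt (on_curve_neg (valP P)).
Definition cpt_add (P Q : EF) : EF := cpt (on_curve_add (valP P) (valP Q)).

Fact cpt_addA : associative cpt_add.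
Proof.
by move=> P Q R; apply: val_inj; rewrite /= (pt_addA smooth) ?(valP _).
Qed.
Fact cpt_addC : commutative cpt_add.
Proof. by move=> P Q; apply: val_inj; rewrite /= pt_addC ?(valP P) ?(valP Q). Qed.
Fact cpt_add0 : left_id cpt_zero cpt_add.
Proof. by move=> P; apply: val_inj. Qed.
Fact cpt_addN : left_inverse cpt_zero cpt_opp cpt_add.
Proof. by move=> P; rewrite cpt_addC; apply: val_inj; apply: pt_addN. Qed.

HB.instance Definition _ :=
  GRing.isZmodule.Build EF cpt_addA cpt_addC cpt_add0 cpt_addN.

Lemma val_cptD (P Q : EF) : val (P + Q) = pt_add W (val P) (val Q).
Proof. by []. Qed.
Lemma val_cptB (P Q : EF) : val (P - Q) = pt_sub W (val P) (val Q).
Proof. by []. Qed.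
Lemma val_cptMn (P : EF) n : val (P *+ n) = pt_muln W n (val P).
Proof. by elim: n => [//|n IHn]; rewrite mulrS val_cptD IHn. Qed.

Definition to_cpt (P : Defs.point F) : EF :=
  insubd (cpt_zero : {Q : Defs.point F | on_curve W Q}) P.

Lemma to_cptK P : E_ W P -> val (to_cpt P) = P.
Proof. exact: insubdK. Qed.

Lemma cptP (P : Defs.point F) : E_ W P -> {Q : EF | P = val Q}.
Proof. by move=> hP; exists (cpt hP). Qed.

End Group.

Section Functoriality.
Variables (W : weierstrass) (F K : fieldType) (f : {rmorphism F -> K}).

Lemma map_pt_neg P : map_pt f (pt_neg W P) = pt_neg W (map_pt f P).
Proof.
by case: P => [[x y]|] //=; rewrite !(rmorphB, rmorphN, rmorphM, rmorph_int).
Qed.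

(** The coefficients of the curve are integers, so a morphism of fields
    commutes with the rational functions that define the sum. *)
Lemma map_pt_add P Q : map_pt f (pt_add W P Q) = pt_add W (map_pt f P) (map_pt f Q).
Proof.
case: P Q => [[x1 y1]|] [[x2 y2]|] //=.
rewrite (inj_eq (fmorph_inj f)).
have -> : (f y1 + f y2 + (wa1 W)%:~R * f x2 + (wa3 W)%:~R == 0) =
    (y1 + y2 + (wa1 W)%:~R * x2 + (wa3 W)%:~R == 0).
  by rewrite -(fmorph_eq0 f) !(rmorphD, rmorphM, rmorph_int).
case: ifP => //= _; set u := (if x1 == x2 then _ else _).
set v := (if x1 == x2 then _ else _).
have -> : v = f u.
  rewrite /v /u; case: ifP => _;
    by rewrite !(rmorph_nat, rmorphB, rmorphD, rmorphM, rmorphXn, rmorph_int, fmorphV).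
by rewrite !(rmorphB, rmorphD, rmorphN, rmorphM, rmorphXn, rmorph_int).
Qed.

Lemma map_pt_sub P Q : map_pt f (pt_sub W P Q) = pt_sub W (map_pt f P) (map_pt f Q).
Proof. by rewrite /pt_sub map_pt_add map_pt_neg. Qed.

Lemma map_pt_on_curve P : on_curve W P -> on_curve W (map_pt f P).
Proof.
case: P => [[x y]|] //= /eqP /(congr1 f) e; apply/eqP; move: e.
by rewrite !(rmorphD, rmorphM, rmorphXn, rmorph_int).
Qed.

End Functoriality.

(** * Lagrange's theorem for groups of classes *)

(** The elements of T represent, through v, elements of the group A, and cl
    sends them to their classes modulo the subgroup B; G and H represent subgroups
    of A / B. The classes of G are partitioned by the cosets of H, each of which is
    the bijective image of the classes of H under subtraction from one of its
    elements. *)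
Lemma card_subquotient_dvd (A : zmodType) (T S : choiceType) (B : A -> Prop)
    (v : T -> A) (cl : T -> S) (G H : set T) :
  (forall a b, B a -> B b -> B (a - b)) ->
  (forall x y, G x -> G y -> cl x = cl y <-> B (v x - v y)) ->
  (forall x y, G x -> G y -> exists2 z, G z & v z = v x - v y) ->
  (forall x y, H x -> H y -> exists2 z, H z & v z = v x - v y) ->
  H `<=` G -> H !=set0 -> finite_set (cl @` G) ->
  (Defs.card (cl @` H) %| Defs.card (cl @` G))%N.
Proof.
move=> Bsub clP Gsub Hsub HG [h0 Hh0] finG.
have B0 : B 0.
  by have /clP := erefl (cl h0); rewrite subrr; apply; apply: HG.
have Bopp a : B a -> B (- a) by move=> Ba; rewrite -sub0r; apply: Bsub.
have Badd a b : B a -> B b -> B (a + b).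
  by move=> Ba Bb; rewrite -[b]opprK; apply: Bsub => //; apply: Bopp.
have finH : finite_set (cl @` H) by apply: sub_finite_set finG; apply: image_subset.
rewrite /Defs.card !cardfE.
set X := fset_set (cl @` G); set Y := fset_set (cl @` H).
have XP (x : X) : exists t, G t /\ cl t = val x.
  by have := valP x; rewrite in_fset_set // in_setE => -[t Gt <-]; exists t.
have YP (y : Y) : exists t, H t /\ cl t = val y.
  by have := valP y; rewrite in_fset_set // in_setE => -[t Ht <-]; exists t.
pose r x := projT1 (cid (XP x)); pose s y := projT1 (cid (YP y)).
have rG x : G (r x) by rewrite /r; case: cid => ? [].
have rE x : cl (r x) = val x by rewrite /r; case: cid => ? [].
have sH y : H (s y) by rewrite /s; case: cid => ? [].
have sE y : cl (s y) = val y by rewrite /s; case: cid => ? [].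
have inX t : G t -> cl t \in X by move=> Gt; rewrite in_fset_set // in_setE; exists t.
have inY t : H t -> cl t \in Y by move=> Ht; rewrite in_fset_set // in_setE; exists t.
pose R (x y : X) := `[< exists2 h, H h & B (v (r x) - v (r y) - v h) >].
have zH : exists2 z, H z & v z = 0.
  by have [z Hz] := Hsub _ _ Hh0 Hh0; rewrite subrr; exists z.
have oppH h : H h -> exists2 z, H z & v z = - v h.
  by have [z Hz z0] := zH => Hh; have [w Hw] := Hsub _ _ Hz Hh;
    rewrite z0 sub0r; exists w.
have addH h k : H h -> H k -> exists2 z, H z & v z = v h + v k.
  move=> Hh /oppH[k' Hk' e]; have [w Hw] := Hsub _ _ Hh Hk'.
  by rewrite e opprK; exists w.
have eqR : {in [set: X]%SET & &, equivalence_rel R}.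
  have Rxx x : R x x.
    by have [z Hz z0] := zH; apply/asboolP; exists z => //; rewrite z0 !subrr.
  have Rsym x y : R x y -> R y x.
    move=> /asboolP[h /oppH[k Hk e] Bh]; apply/asboolP; exists k => //.
    by rewrite e; have := Bopp _ Bh; congr B; rewrite !opprD !opprK [- _ + _]addrC.
  have Rtrans y x z : R x y -> R y z -> R x z.
    move=> /asboolP[h Hh Bh] /asboolP[k Hk Bk].
    have [w Hw e] := addH _ _ Hh Hk; apply/asboolP; exists w => //.
    by have := Badd _ _ Bh Bk; congr B; rewrite e addrACA subrKA opprD.
  move=> x y z _ _ _; split=> // Rxy; apply/idP/idP; last exact: Rtrans.
  by apply: Rtrans; apply: Rsym.
have partP := equivalence_partitionP eqR.
rewrite -(@cardsT X).
rewrite (card_uniform_partition (n := #|{: Y}|) _ partP) ?dvdn_mull // =>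
  C /imsetP[x _ ->{C}].
(* The coset of x is the image of the injection sending h to x - h. *)
have /choice[f fP] (y : Y) : exists z : X, B (v (r z) - (v (r x) - v (s y))).
  have [t Gt e] := Gsub _ _ (rG x) (HG _ (sH y)).
  exists [` inX t Gt]%fset; rewrite -e; apply/clP => //; exact: rE.
have fI : injective f.
  move=> y y' e; apply: val_inj; rewrite -!sE; apply/clP; do ?by apply/HG/sH.
  have := Bsub _ _ (fP y) (fP y'); rewrite -e; congr B.
  by rewrite (opprB (v (r (f y)))) addrC subrKA opprB addrC subrKA.
rewrite -(@cardsT Y) -(card_imset _ fI); apply: eq_card => y.
rewrite !inE /=; apply/asboolP/imsetP => [[h Hh Bh] | [z _ ->]].
  exists [` inY h Hh]%fset; first by rewrite finset.in_setT.
  apply: val_inj; rewrite -!rE.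
  set y' := [` _]%fset.
  have /clP Bs : cl (s y') = cl h by rewrite sE.
  apply/esym/clP => //; have := Badd _ _ (fP y') (Bsub _ _ Bh (Bs _ _)).
  move=> /(_ (HG _ (sH _)) (HG _ Hh)); congr B.
  by rewrite (opprB (v (s y'))) subrKA [_ - _ - v (s y')]addrAC subrKA.
exists (s z); first exact: sH.
have := Bopp _ (fP z); congr B.
by rewrite opprB -addrA [- _ - _]addrC addrA.
Qed.

(** * The p-primary part of the Tate-Shafarevich group *)

Lemma Gal_rmorphism (F : fieldType) (L : set F) (s : F -> F) :
  Defs.Gal L s -> {f : {rmorphism F -> F} | s = f}.
Proof.
move=> [sB sM _ _].
pose sA := GRing.isZmodMorphism.Build F F s sB.
pose sR := GRing.isMonoidMorphism.Build F F s sM.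
pose f : {rmorphism F -> F} := HB.pack s sA sR.
by exists f.
Qed.

Section Cohomology.
Variables (W : weierstrass) (smooth : disc W != 0).

Lemma smooth_num (F : numFieldType) : (disc W)%:~R != 0 :> F.
Proof. by rewrite intr_eq0. Qed.

Let smooth_algC : (disc W)%:~R != 0 :> (algC : fieldType) := smooth_num algC.

Lemma smooth_padic p (K : padic_closure p) : (disc W)%:~R != 0 :> K.
Proof. by rewrite intr_pc_eq0. Qed.

Local Notation EQ := (curve_point smooth_algC).
Local Notation sub c d := (fun s => pt_sub W (c s) (d s)).
Implicit Types c d : cochain.

Lemma cocycle_sub c d :
  cocycle W GQ (E_ W) c -> cocycle W GQ (E_ W) d -> cocycle W GQ (E_ W) (sub c d).
Proof.
move=> [cE cM cC] [dE dM dC]; split.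
- move=> s Gs; have [P ->] := cptP smooth_algC (cE s Gs).
  have [Q ->] := cptP smooth_algC (dE s Gs).
  by rewrite -val_cptB; apply: valP (P - Q).
- move=> s t Gs Gt; rewrite cM // dM //; have [f ef] := Gal_rmorphism Gs.
  rewrite ef map_pt_sub -ef.
  have hcs := cE s Gs; have hct := map_pt_on_curve f (cE t Gt).
  have hds := dE s Gs; have hdt := map_pt_on_curve f (dE t Gt).
  rewrite -ef in hct hdt.
  have [P ->] := cptP smooth_algC hcs.
  have [Q ->] := cptP smooth_algC hct.
  have [P' ->] := cptP smooth_algC hds.
  have [Q' ->] := cptP smooth_algC hdt.
  by rewrite -!val_cptB -!val_cptD -val_cptB; congr val; rewrite opprD addrACA.
move=> s Gs; have [xs hxs] := cC s Gs; have [ys hys] := dC s Gs.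
exists (xs ++ ys) => t Gt e; rewrite hxs ?hys // => x hx; apply: e.
  by rewrite mem_cat hx orbT.
by rewrite mem_cat hx.
Qed.

Lemma locally_trivial_sub (K : fieldType) (L : {rmorphism algC -> K} -> set K) c d :
  (disc W)%:~R != 0 :> K ->
  locally_trivial W L c -> locally_trivial W L d -> locally_trivial W L (sub c d).
Proof.
move=> smK hc hd j; have [P hP cP] := hc j; have [Q hQ dQ] := hd j.
have [P' eP] := cptP smK hP; have [Q' eQ] := cptP smK hQ.
exists (pt_sub W P Q); first by rewrite eP eQ -val_cptB; apply: valP (P' - Q').
move=> t Gt; rewrite map_pt_sub cP // dQ //; have [f ef] := Gal_rmorphism Gt.
have htP := map_pt_on_curve f hP; have htQ := map_pt_on_curve f hQ.
rewrite ef map_pt_sub.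
have [P'' ->] := cptP smK htP; have [Q'' ->] := cptP smK htQ.
by rewrite eP eQ -!val_cptB; congr val; rewrite !opprD !opprK addrACA.
Qed.

Definition coboundary (a : {s | GQ s} -> EQ) : Prop :=
  exists P : EQ, forall s, val (a s) = pt_sub W (map_pt (sval s) (val P)) (val P).

Lemma coboundary_sub a b : coboundary a -> coboundary b -> coboundary (a - b).
Proof.
move=> [P aP] [Q bQ]; exists (P - Q) => s.
have [f ef] := Gal_rmorphism (svalP s).
rewrite [(a - b) s]/(a s - b s) !val_cptB aP bQ ef map_pt_sub.
have [P' ->] := cptP smooth_algC (map_pt_on_curve f (valP P)).
have [Q' ->] := cptP smooth_algC (map_pt_on_curve f (valP Q)).
by rewrite -!val_cptB; congr val; rewrite !opprD !opprK addrACA.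
Qed.

Lemma coboundary0 : coboundary 0.
Proof. by exists 0 => s. Qed.

(** Values of cochains outside the Galois group are arbitrary, and need not lie
    on the curve; the restriction to the group lives in an abelian group for
    pointwise addition. *)
Definition lift c (s : {s | GQ s}) : EQ := to_cpt smooth_algC (c (sval s)).

Lemma val_lift c s : (forall s, GQ s -> E_ W (c s)) -> val (lift c s) = c (sval s).
Proof. by move=> cE; rewrite to_cptK //; apply: cE (svalP s). Qed.

Lemma cohomologousP c d :
  (forall s, GQ s -> E_ W (c s)) -> (forall s, GQ s -> E_ W (d s)) ->
  cohomologous W GQ (E_ W) c d <-> coboundary (lift c - lift d).
Proof.
move=> cE dE; split=> [[P hP e] | [P e]].
  have [P' eP] := cptP smooth_algC hP; rewrite {}eP in hP e.
  exists P' => s.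
  have [f ef] := Gal_rmorphism (svalP s).
  rewrite [(_ - _) s]/(lift c s - lift d s) val_cptB !val_lift // (e _ (svalP s)).
  have [D ->] := cptP smooth_algC (dE _ (svalP s)); rewrite ef.
  have [Q ->] := cptP smooth_algC (map_pt_on_curve f hP).
  by rewrite -!val_cptB -val_cptD -val_cptB; congr val; rewrite addrAC subrr add0r.
exists (val P); first exact: valP P.
move=> s Gs; pose s' : {s | GQ s} := exist _ s Gs.
have <- : val (lift c s' - lift d s') = pt_sub W (map_pt s (val P)) (val P) := e s'.
rewrite -[c s](val_lift s' cE) -[d s](val_lift s' dE).
by rewrite -val_cptD; congr val; rewrite addrC subrK.
Qed.

Lemma coh_classP c d : cocycle W GQ (E_ W) c -> cocycle W GQ (E_ W) d ->
  coh_class W GQ (E_ W) c = coh_class W GQ (E_ W) d <->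
  coboundary (lift c - lift d).
Proof.
move=> hc hd; have [cE _ _] := hc; have [dE _ _] := hd.
split=> [e | Bcd].
  apply/cohomologousP => //.
  have : coh_class W GQ (E_ W) d d by split=> //; apply/cohomologousP;
    rewrite ?subrr //; apply: coboundary0.
  by rewrite -e => -[].
have Bdc : coboundary (lift d - lift c).
  by have := coboundary_sub coboundary0 Bcd; rewrite sub0r opprB.
apply/seteqP; split=> x [xc xh]; split=> //; have [xE _ _] := xc;
  have /cohomologousP B := xh; apply/cohomologousP => //.
  have := coboundary_sub (B cE xE) Bcd; rewrite opprB addrC.
  by rewrite addrA subrK.
have := coboundary_sub (B dE xE) Bdc; rewrite opprB addrC.
by rewrite addrA subrK.
Qed.

Section Sha.
Variables (R : realType) (Qbar : forall l : prime_number, padic_closure l).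

Lemma sha_cocycle_sub c d : sha_cocycle R Qbar W c -> sha_cocycle R Qbar W d ->
  sha_cocycle R Qbar W (sub c d).
Proof.
move=> [c1 c2 c3] [d1 d2 d3]; split.
- exact: cocycle_sub.
- by move=> l; apply: locally_trivial_sub (smooth_padic _) (c2 l) (d2 l).
exact: locally_trivial_sub (smooth_num _) c3 d3.
Qed.

Lemma lift_sub c d : (forall s, GQ s -> E_ W (c s)) -> (forall s, GQ s -> E_ W (d s)) ->
  lift (sub c d) = lift c - lift d.
Proof.
move=> cE dE; apply/funext => s; apply: val_inj.
rewrite [(_ - _) s]/(lift c s - lift d s) val_cptB !val_lift // => t Gt.
by apply: on_curve_sub; [apply: cE | apply: dE].
Qed.

Lemma lift_muln c n : (forall s, GQ s -> E_ W (c s)) ->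
  lift (fun s => pt_muln W n (c s)) = lift c *+ n.
Proof.
move=> cE; apply/funext => s; apply: val_inj.
have -> : (lift c *+ n) s = lift c s *+ n.
  by elim: n => // n IHn; rewrite !mulrS -IHn.
by rewrite val_cptMn !val_lift // => t Gt; apply/on_curve_muln/cE.
Qed.

(** If p^k c and p^l d are coboundaries, so is p^(k+l) (c - d); hence the classes
    killed by a power of p form a subgroup of Sha. *)
Lemma card_Sha_p_dvd p :
  finite_set (Sha R Qbar W) ->
  (Defs.card (Sha_p R Qbar W p) %| Defs.card (Sha R Qbar W))%N.
Proof.
move=> finS.
have shaE c : sha_cocycle R Qbar W c -> forall s, GQ s -> E_ W (c s) by move=> [[]].
have None_E s : GQ s -> E_ W ((fun=> None) s : Defs.point algC) by [].
have lift0 : lift (fun=> None) = 0.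
  by apply/funext => s; apply: val_inj; rewrite val_lift.
have muln_E c n : (forall s, GQ s -> E_ W (c s)) ->
    forall s, GQ s -> E_ W (pt_muln W n (c s)).
  by move=> cE s Gs; apply/on_curve_muln/cE.
have tP c k : sha_cocycle R Qbar W c ->
    cohomologous W GQ (E_ W) (fun s => pt_muln W (p ^ k) (c s)) (fun=> None) <->
    coboundary (lift c *+ p ^ k).
  move=> /shaE cE; rewrite cohomologousP //; last exact: muln_E.
  by rewrite lift0 subr0 lift_muln.
apply: (card_subquotient_dvd (v := lift) coboundary_sub) => //.
- by move=> c d [cc _ _] [dc _ _]; apply: coh_classP.
- move=> c d hc hd; exists (sub c d); first exact: sha_cocycle_sub.
  by rewrite lift_sub //; apply: shaE.
- move=> c d [hc [k hk]] [hd [l hl]]; exists (sub c d); last first.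
    by rewrite lift_sub //; apply: shaE.
  split; first exact: sha_cocycle_sub.
  exists (k + l)%N; apply/tP; first exact: sha_cocycle_sub.
  rewrite lift_sub; try exact: shaE.
  have BM a n : coboundary a -> coboundary (a *+ n).
    move=> Ba; elim: n => [|n IHn]; first exact: coboundary0.
    rewrite mulrSr -[a in _ + a]opprK; apply: coboundary_sub => //.
    by rewrite -sub0r; apply: coboundary_sub => //; apply: coboundary0.
  rewrite mulrnBl {1}expnD mulrnA addnC expnD mulrnA.
  by apply: coboundary_sub; apply: BM; apply/tP.
- by move=> c [].
have sha0 : sha_cocycle R Qbar W (fun=> None).
  split; [split=> // s _; exists [::] => // | move=> l j | move=> j];
    by exists None.
by exists (fun=> None); split=> //; exists 0%N; apply/tP;
  rewrite // lift0 mul0rn; apply: coboundary0.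
Qed.

End Sha.
End Cohomology.

(** * The characteristic element under the conjecture *)

(** This holds even if no pair of regulators exists, the value being then 0. *)
Lemma signed_regulator_Qp (Qbar : forall l : prime_number, padic_closure l)
    (E : elliptic_curve) (p : prime_number) (r : nat) (e : sign) :
  Qp (Qbar p) (signed_regulator Qbar E p r e).
Proof.
rewrite /signed_regulator; case: xgetP => [x _ [Rp [Rm [[Qp_p Qp_m _] ->]]]|_].
  by case: e.
by move=> N; exists 0; [exists 0; rewrite // /ratr mul0r | left; rewrite subrr].
Qed.

Theorem theorem3p16 (R : realType)
    (Qbar : forall l : prime_number, padic_closure l)
    (gamma gamma_inv : prime_number -> algC -> algC)
    (hgamma : forall p : prime_number, odd p -> cyc_generator p (gamma p) (gamma_inv p))
    (E : elliptic_curve) (rE : nat) (hrank : mw_rank E rE) (hrE : (1 <= rE)%N)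
    (hSha : finite_set (Sha R Qbar E))
    (e : sign)
    (hBSD : padic_BSD R Qbar E rE e gamma gamma_inv) :
  forall p : prime_number,
    (Sss E `\` (Sigma_anom E `|` Sigma' R Qbar E `|` Pi_ Qbar E rE e)) p ->
    a_ E p = 0 ->
    forall (ms : seq nat) (hs : seq {poly Qbar p}),
      Sel_structure Qbar E p e (gamma p) (gamma_inv p) ms hs ->
      [/\ char_elt p ms hs = 'X^rE, mu_inv ms = 0%N & lambda_inv hs = rE].
Proof.
move=> p [ssp nSig] ap0 ms hs hSel.
have p_pr := prime_valP p.
have nSig' : ~ Sigma' R Qbar E p by move=> h; apply: nSig; left; right.
have nPi : ~ vge (signed_regulator Qbar E p rE e / p%:R ^+ rE) 1.
  by move=> h; apply: nSig; right.
have podd : odd p.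
  by apply: contra_notT nSig' => np; constructor 1; case: (even_prime p_pr) np => // ->.
have [q [Lq fq [u [_ nu vu] q0]]] := hBSD p podd ssp ap0 ms hs hSel.
set rho := _ / _ in nPi q0.
have [nrho vrho] : rho != 0 /\ pc_val rho <= 0.
  have nrho : rho != 0 by apply: contra_notN nPi => /eqP->; left.
  split=> //; have npr : (p%:R : Qbar p) ^+ rE != 0.
    by rewrite -natrX natr_pc_eq0 -lt0n expn_gt0 prime_gt0.
  have nreg : signed_regulator Qbar E p rE e != 0.
    by apply: contraNneq nrho => z; rewrite /rho z mul0r.
  have [z ez] := Qp_val_int p_pr (signed_regulator_Qp _ _ _ _ _) nreg.
  have vp : pc_val ((p%:R : Qbar p) ^+ rE) = rE%:R.
    by rewrite -natrX pc_val_expp.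
  have erho : pc_val rho = (z - rE%:Z)%:~R.
    by rewrite /rho pc_valM ?invr_eq0 // pc_valV // vp ez rmorphB.
  rewrite erho -[0]/(0%:~R) ler_int -ltzD1 add0r -(ltr_int rat) -erho ltNge.
  by apply/negP => le1; apply: nPi; right.
clearbody rho.
have unit_nat (m : nat) : ~ (p %| m)%N ->
    m%:R != 0 :> Qbar p /\ pc_val (m%:R : Qbar p) = 0.
  move=> /negP pm; split; last by rewrite pc_val_coprime // prime_coprime.
  by rewrite natr_pc_eq0; apply: contraNneq pm => ->.
have [nS vS] : (Defs.card (Sha_p R Qbar E p))%:R != 0 :> Qbar p /\
    pc_val ((Defs.card (Sha_p R Qbar E p))%:R : Qbar p) = 0.
  apply: unit_nat => pS; apply: nSig'; constructor 2.
  by apply: dvdn_trans pS (card_Sha_p_dvd (ec_disc E) p hSha).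
have [nt vt] : (tamagawa_product Qbar E)%:R != 0 :> Qbar p /\
    pc_val ((tamagawa_product Qbar E)%:R : Qbar p) = 0.
  by apply: unit_nat => pt; apply: nSig'; constructor 3.
have nq0 : q 0%N != 0 by rewrite q0 !mulf_neq0.
have [_ hhs _] := hSel.
apply: (char_elt_unit hhs fq nq0).
by rewrite q0 !pc_valM ?mulf_neq0 // vS vt vu !addr0.
Qed.
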